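(* For a generic ruled surface $R$ in $\mathbb R^4$, there is a regular curve on $R$ formed by inflection points of real type which is transverse to the ruling $R_0$ (this curve is called the inflection curve).
   Context: Ruled surface: $I\subset\mathbb R$ is an open interval containing $0$, $\mathbf x:I\to\mathbb R^4$ and $\mathbf e:I\to\mathbb R^4\setminus\{0\}$ are smooth, $F(u,t)=\mathbf x(u)+t\,\mathbf e(u)$, $R=F(I\times\mathbb R)$, and $R_u=\{\mathbf x(u)+t\mathbf e(u):t\in\mathbb R\}$ is the ruling at $u$. Only smooth points (where $F$ is immersive) and non-developable surfaces are considered, i.e. $\mathbf x'(u),\mathbf e(u),\mathbf e'(u)$ are linearly independent for every $u$. ''Generic'' means: for $(\mathbf x,\mathbf e)$ in a residual subset of the space of such pairs (Whitney $C^\infty$ topology). Inflection point of real type: near $p$, choose affine coordinates centred at $p$ in which the surface is the graph $(x,y,f^1(x,y),f^2(x,y))$ with $j^1f^i(0,0)=0$. Let the 2-jets of $f^1,f^2$ be $lx^2+2mxy+ny^2$ and $ax^2+2bxy+cy^2$. Then $p$ is an inflection point of real type if the matrix $\begin{pmatrix}a&b&c\\ l&m&n\end{pmatrix}$ has rank $1$ and $K(p)=ac-b^2+ln-m^2<0$. *)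

(* Defs.v *)
From HB Require Import structures.
From mathcomp Require Import all_boot all_order all_algebra.
From mathcomp Require Import all_classical all_reals all_analysis.

Set Implicit Arguments.
Unset Strict Implicit.
Unset Printing Implicit Defensive.

Import Order.TTheory GRing.Theory Num.Theory.
Import numFieldNormedType.Exports.

Local Open Scope ring_scope.
Local Open Scope classical_set_scope.

(* J is meant to be open; values outside J are irrelevant. *)
Definition smooth_curve (R : realType) (V : normedModType R) (J : set R)
    (f : R -> V) : Prop :=
  forall (n : nat) (s : R), J s -> derivable (derive1n n f) s 1.

(* C^oo on the open set A: every iterated directional derivative of f is
   differentiable on A. *)
Definition smooth_on (R : realType) (E V : normedModType R) (A : set E)
    (f : E -> V) : Prop :=
  forall (vs : seq E) (p : E), A p ->
    differentiable (foldr (fun v g => 'D_v g) f vs) p.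

(* Data of the non-developable ruled surfaces over I whose points are all
   smooth; x and e are total functions of which only the restriction to I
   matters. *)
Record ruled_data (R : realType) (I : set R) : Type := RuledData {
  rd_x : R -> 'rV[R]_4 ;
  rd_e : R -> 'rV[R]_4 ;
  rd_x_smooth : smooth_curve I rd_x ;
  rd_e_smooth : smooth_curve I rd_e ;
  rd_e_neq0 : forall u, I u -> rd_e u != 0 ;
  rd_indep : forall u, I u ->
    row_free (col_mx (derive1 rd_x u) (col_mx (rd_e u) (derive1 rd_e u)))
}.

(* Basic neighbourhoods of the Whitney C^oo topology on maps I -> R^4 x R^4:
   the derivatives up to order k differ by less than a positive continuous
   function d on I, which may tend to 0 at the ends of I. *)
Definition whitney_ball (R : realType) (I : set R) (k : nat) (d : R -> R)
    (g : ruled_data I) : set (ruled_data I) :=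
  [set h | forall (j : nat) (u : R), (j <= k)%N -> I u ->
     `|derive1n j (rd_x h) u - derive1n j (rd_x g) u| < d u /\
     `|derive1n j (rd_e h) u - derive1n j (rd_e g) u| < d u].

Definition whitney_radius (R : realType) (I : set R) (d : R -> R) : Prop :=
  forall u, I u -> 0 < d u /\ {for u, continuous d}.

Definition whitney_open (R : realType) (I : set R) (O : set (ruled_data I))
    : Prop :=
  forall g, O g -> exists (k : nat) (d : R -> R),
    whitney_radius I d /\ whitney_ball k d g `<=` O.

Lemma whitney_openT (R : realType) (I : set R) :
  whitney_open [set: ruled_data I].
Proof.
move=> g _; exists 0%N, (fun=> 1); split => // u _; split => //.
exact: cvg_cst.
Qed.

Lemma whitney_openI (R : realType) (I : set R) :
  setI_closed (@whitney_open R I).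
Proof.
move=> A B oA oB g [/oA [k [d [d0 dA]]] /oB [l [c [c0 cB]]]].
exists (maxn k l), (d \min c); split.
  move=> u Iu; have [d1 d2] := d0 u Iu; have [c1 c2] := c0 u Iu.
  by split; [rewrite /= lt_min d1|exact: (@continuous_min R R d c u)].
move=> h hh; split; [apply: dA|apply: cB] => j u jk Iu.
  have [] := hh j u (leq_trans jk (leq_maxl _ _)) Iu.
  by rewrite /= !lt_min => /andP[-> _] /andP[-> _].
have [] := hh j u (leq_trans jk (leq_maxr _ _)) Iu.
by rewrite /= !lt_min => /andP[_ ->] /andP[_ ->].
Qed.

Lemma whitney_open_bigU (R : realType) (I : set R) (T : Type)
    (O : T -> set (ruled_data I)) :
  (forall i, whitney_open (O i)) -> whitney_open (\bigcup_i O i).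
Proof.
move=> oO g [i _ /oO [k [d [d0 dO]]]]; exists k, d; split => // h /dO Oh.
by exists i.
Qed.

HB.instance Definition _ (R : realType) (I : set R) :=
  gen_eqMixin (ruled_data I).
HB.instance Definition _ (R : realType) (I : set R) :=
  gen_choiceMixin (ruled_data I).
HB.instance Definition _ (R : realType) (I : set R) :=
  isOpenTopological.Build (ruled_data I)
    (@whitney_openT R I) (@whitney_openI R I) (@whitney_open_bigU R I).

Definition residual (T : topologicalType) (S : set T) : Prop :=
  exists O : (set T)^nat,
    (forall i, open (O i) /\ dense (O i)) /\ \bigcap_i O i `<=` S.

Definition ruled_map (R : realType) (I : set R) (g : ruled_data I) (u t : R)
    : 'rV[R]_4 :=
  rd_x g u + t *: rd_e g u.

(* The 2-jet of f at the origin is l x^2 + 2 m x y + n y^2 (in particular its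
   1-jet vanishes). *)
Definition quadratic_2jet (R : realType) (f : 'rV[R]_2 -> R) (l m n : R)
    : Prop :=
  let X : 'rV[R]_2 := delta_mx 0 0 in
  let Y : 'rV[R]_2 := delta_mx 0 1 in
  [/\ f 0 = 0, 'D_X f 0 = 0 & 'D_Y f 0 = 0] /\
  [/\ 'D_X ('D_X f) 0 = 2 * l, 'D_X ('D_Y f) 0 = 2 * m
    & 'D_Y ('D_Y f) 0 = 2 * n].

(* q |-> (q - p) *m M are affine coordinates centred at p = ruled_map g u t in
   which the surface near p is the graph (x, y, f1(x, y), f2(x, y)) of smooth
   functions over an open neighbourhood V of the origin. The surface may cross
   itself, so "near p" refers to the image of a neighbourhood U of the
   parameter (u, t). *)
Definition monge_chart (R : realType) (I : set R) (g : ruled_data I) (u t : R)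
    (M : 'M[R]_4) (V : set 'rV[R]_2) (f1 f2 : 'rV[R]_2 -> R) : Prop :=
  [/\ M \in unitmx, open V, V 0, smooth_on V f1 & smooth_on V f2] /\
  exists U : set (R * R),
    [/\ open U, U (u, t), U `<=` I `*` setT
      & [set (ruled_map g z.1 z.2 - ruled_map g u t) *m M | z in U] =
        [set \row_(i < 4) [:: w 0 0; w 0 1; f1 w; f2 w]`_i | w in V]].

Definition inflection_matrix (R : realType) (l m n a b c : R) : 'M[R]_(1 + 1, 3) :=
  col_mx (\row_(j < 3) [:: a; b; c]`_j) (\row_(j < 3) [:: l; m; n]`_j).

Definition real_inflection (R : realType) (I : set R) (g : ruled_data I)
    (u t : R) : Prop :=
  exists (M : 'M[R]_4) (V : set 'rV[R]_2) (f1 f2 : 'rV[R]_2 -> R)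
         (l m n a b c : R),
    [/\ monge_chart g u t M V f1 f2,
        quadratic_2jet f1 l m n, quadratic_2jet f2 a b c,
        \rank (inflection_matrix l m n a b c) = 1%N
      & a * c - b ^+ 2 + l * n - m ^+ 2 < 0].

Definition tangent_plane (R : realType) (I : set R) (g : ruled_data I)
    (u t : R) : 'M[R]_(1 + 1, 4) :=
  col_mx (derive1 (ruled_map g ^~ t) u) (derive1 (ruled_map g u) t).

(* s |-> ruled_map g (u s) (t s), for s in the open interval J, is a regular
   curve on the surface. *)
Definition regular_curve_on (R : realType) (I : set R) (g : ruled_data I)
    (J : set R) (u t : R -> R) : Prop :=
  [/\ open J, is_interval J, smooth_curve J u,
      smooth_curve J t
    & forall s, J s ->
        I (u s) /\ derive1 (fun r => ruled_map g (u r) (t r)) s != 0].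

(* The curve meets the ruling R_u0, and wherever it does, its tangent line and
   the ruling together span the tangent plane of the surface. *)
Definition transverse_to_ruling (R : realType) (I : set R) (g : ruled_data I)
    (J : set R) (u t : R -> R) (u0 : R) : Prop :=
  (exists s, J s /\ u s = u0) /\
  forall s, J s -> u s = u0 ->
    (derive1 (fun r => ruled_map g (u r) (t r)) s + rd_e g u0
       == tangent_plane g u0 (t s))%MS.

(* Main.v *)
(** Modulo the tangent plane at (u, t), the second fundamental form of
    F(u, t) = x(u) + t e(u) has the entries F_uu = x'' + t e'', F_ut = e' and
    F_tt = 0, where e' is nonzero.  Hence the point is an inflection point
    exactly when x'' + t e'' lies in span(x', e, e'), and then it is of real
    type because of the null direction e.  If det(x', e, e', e'')(0) <> 0,
    this is a linear equation for t with smooth coefficients near u = 0; its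
    solution t(u) gives the inflection curve u |-> F(u, t(u)), which is
    transverse to the rulings since u is its parameter.

    The condition det(x', e, e', e'')(0) <> 0 is open.  It is dense because
    adding eps phi(u) v to e, with phi a bump function vanishing to second
    order at 0, adds a multiple of v to e''(0) and changes neither e(0) nor
    e'(0).  If v is independent of x'(0), e(0), e'(0) and phi has small support,
    then x', e, e' stay independent for every eps: modulo v they do not change,
    and v is independent of them on the support of phi. *)

Require Import Defs.
From HB Require Import structures.
From mathcomp Require Import all_boot all_order all_algebra.
From mathcomp Require Import all_classical all_reals all_analysis.
From mathcomp Require Import ring lra.

Set Implicit Arguments.
Unset Strict Implicit.
Unset Printing Implicit Defensive.

Import Order.TTheory GRing.Theory Num.Theory.
Import numFieldNormedType.Exports.

Local Open Scope ring_scope.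
Local Open Scope classical_set_scope.

(** * Iterated directional differentiability *)

(** An explicit epsilon estimate is the little-o expansion, and a continuous linear map satisfying
    it is the differential by uniqueness. It serves wherever no differentiation rule applies: for
    the implicit function and for the flat function at 0. *)
Lemma linear_approx_diff (R : realType) (E V : normedModType R) (f : E -> V)
    (L : {linear E -> V}) (x : E) :
  continuous L ->
  (forall eps, 0 < eps ->
     \forall h \near 0, `|f (h + x) - f x - L h| <= eps * `|h|) ->
  differentiable f x /\ 'd f x = L :> (E -> V).
Proof.
move=> cL fL; have H : f \o shift x = cst (f x) + L +o_ 0 id.
  apply/eqaddoP => eps eps0; apply: filterS (fL _ eps0) => h.
  by rewrite !fctE opprD addrA.
have dfL := diff_unique cL H.
by split=> //; apply/diff_locallyP; rewrite dfL.
Qed.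

Lemma near_eq_differentiable (R : realType) (E V : normedModType R)
    (f g : E -> V) (x : E) :
  (\forall y \near x, f y = g y) -> differentiable f x -> differentiable g x.
Proof.
move=> fg /diff_locallyP[cL /eqaddoP fL].
apply: (proj1 (@linear_approx_diff _ _ _ g ('d f x) x cL _)).
move=> eps eps0; have /(_ eps eps0) := fL.
have : \forall h \near 0, f (h + x) = g (h + x).
  have := fg; rewrite (near_shift 0) => /=; apply: filterS => h /=.
  by rewrite subr0.
apply: filterS2 => h fgh.
by rewrite !fctE -fgh -(nbhs_singleton fg) opprD addrA.
Qed.

(** Finite levels of smoothness, made for induction on [n]: the directional derivatives of order
    less than [n] are differentiable on [A]. Continuity of those of order [n] is not demanded, but
    holding for all [n] is being C^oo. *)
Fixpoint Ck (R : realType) (E V : normedModType R) (n : nat) (A : set E)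
    (f : E -> V) : Prop :=
  if n is n'.+1 then
    (forall p, A p -> differentiable f p) /\ forall v, Ck n' A ('D_v f)
  else True.

Section Ck_general.
Context (R : realType) (E V : normedModType R).
Implicit Types (f g : E -> V) (A B : set E).

Lemma Ck_diff n A f p : Ck n.+1 A f -> A p -> differentiable f p.
Proof. by case=> + _; apply. Qed.

(** On an open set, agreement on [A] is agreement near each of its points, so it passes to all
    derivatives. *)
Lemma Ck_eq n A f g : open A -> (forall p, A p -> f p = g p) ->
  Ck n A f -> Ck n A g.
Proof.
move=> oA; elim: n f g => [//|n IH] f g fg /= [df Df].
have nfg p : A p -> \near p, f p = g p.
  by move=> Ap; apply: filterS (open_nbhs_nbhs (conj oA Ap)) => q /fg.
split=> [p Ap|v].
  exact: near_eq_differentiable (nfg _ Ap) (df _ Ap).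
apply: IH (Df v) => p Ap.
exact: near_eq_derive (nfg _ Ap).
Qed.

Lemma Ck_subset n A B f : B `<=` A -> Ck n A f -> Ck n B f.
Proof.
move=> BA; elim: n f => [//|n IH] f [df Df]; split=> [p /BA /df //|v].
exact: IH (Df v).
Qed.

Lemma CkW n A f : Ck n.+1 A f -> Ck n A f.
Proof.
elim: n f => [//|n IH] f [df Df]; split=> [//|v]; exact: IH (Df v).
Qed.

Lemma Ck_cst n A (c : V) : Ck n A (fun=> c).
Proof.
elim: n c => [//|n IH] c; split=> [p Ap|v]; first exact: differentiable_cst.
have -> : 'D_v (fun=> c) = fun=> 0 by apply/funext => p; exact: derive_cst.
exact: IH.
Qed.

Lemma CkD n A f g : open A -> Ck n A f -> Ck n A g ->
  Ck n A (fun p => f p + g p).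
Proof.
move=> oA; elim: n f g => [//|n IH] f g [df Df] [dg Dg]; split=> [p Ap|v].
  by apply: differentiableD; [exact: df|exact: dg].
apply: Ck_eq (IH _ _ (Df v) (Dg v)) => // p Ap.
by rewrite [RHS]deriveD //; apply: diff_derivable; [exact: df|exact: dg].
Qed.

Lemma CkZ n A f (c : R) : open A -> Ck n A f -> Ck n A (fun p => c *: f p).
Proof.
move=> oA; elim: n f => [//|n IH] f [df Df]; split=> [p Ap|v].
  by apply: differentiableZ; exact: df.
apply: Ck_eq (IH _ (Df v)) => // p Ap.
by rewrite [RHS]deriveZ //; apply: diff_derivable; exact: df.
Qed.

Lemma Ck_linear n A (f : {linear E -> V}) : continuous f -> Ck n A f.
Proof.
move=> cf; case: n => [//|n]; split=> [p _|v].
  exact: linear_differentiable.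
have -> : 'D_v f = fun=> f v.
  apply/funext => p; rewrite deriveE; first by rewrite diff_lin.
  exact: linear_differentiable.
exact: Ck_cst.
Qed.

End Ck_general.

Section Ck_scalar.
Context (R : realType) (E : normedModType R).
Implicit Types (f g : E -> R) (A : set E).

Lemma CkM n A f g : open A -> Ck n A f -> Ck n A g ->
  Ck n A (fun p => f p * g p).
Proof.
move=> oA; elim: n f g => [//|n IH] f g Cf Cg; split=> [p Ap|v].
  by apply: differentiableM; [exact: Ck_diff Cf Ap|exact: Ck_diff Cg Ap].
have Cf' := CkW Cf; have Cg' := CkW Cg.
apply: Ck_eq (CkD oA (IH _ _ Cf' (Cg.2 v)) (IH _ _ Cg' (Cf.2 v))) => // p Ap.
rewrite [RHS]deriveM //; apply: diff_derivable.
  exact: Ck_diff Cf Ap.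
exact: Ck_diff Cg Ap.
Qed.

Lemma CkN n A f : open A -> Ck n A f -> Ck n A (fun p => - f p).
Proof.
move=> oA /(CkZ (-1) oA); apply: Ck_eq => // p _; exact: scaleN1r.
Qed.

Lemma CkB n A f g : open A -> Ck n A f -> Ck n A g ->
  Ck n A (fun p => f p - g p).
Proof. by move=> oA Cf Cg; apply: CkD => //; exact: CkN. Qed.

(** The derivative of 1/f is -(1/f)^2 Df, where 1/f is already known to be smooth to the order
    required by induction. *)
Lemma CkV n A f : open A -> (forall p, A p -> f p != 0) -> Ck n A f ->
  Ck n A (fun p => (f p)^-1).
Proof.
move=> oA f0; elim: n => [//|n IH] Cf; split=> [p Ap|v].
  by apply: differentiableV; [exact: Ck_diff Cf Ap|exact: f0].
have Ci := IH (CkW Cf).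
apply: Ck_eq (CkN oA (CkM oA (CkM oA Ci Ci) (Cf.2 v))) => // p Ap.
rewrite [RHS]deriveV ?f0//; last exact/diff_derivable/(Ck_diff Cf).
by rewrite -exprVn expr2 scaleNr.
Qed.

Lemma Ck_sum n A (I : Type) (r : seq I) (P : pred I) (F : I -> E -> R) :
  open A -> (forall i, Ck n A (F i)) ->
  Ck n A (fun p => \sum_(i <- r | P i) F i p).
Proof.
move=> oA CF; elim: r => [|i r IH].
  by apply: Ck_eq (Ck_cst n A 0) => // p _; rewrite big_nil.
case Pi: (P i); last by apply: Ck_eq IH => // p _; rewrite big_cons Pi.
by apply: Ck_eq (CkD oA (CF i) IH) => // p _; rewrite big_cons Pi.
Qed.

Lemma Ck_prod n A (I : Type) (r : seq I) (P : pred I) (F : I -> E -> R) :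
  open A -> (forall i, Ck n A (F i)) ->
  Ck n A (fun p => \prod_(i <- r | P i) F i p).
Proof.
move=> oA CF; elim: r => [|i r IH].
  by apply: Ck_eq (Ck_cst n A (1 : R)) => // p _; rewrite big_nil.
case Pi: (P i); last by apply: Ck_eq IH => // p _; rewrite big_cons Pi.
by apply: Ck_eq (CkM oA (CF i) IH) => // p _; rewrite big_cons Pi.
Qed.

Lemma derive_comp_real (h : R -> R) f p v :
  differentiable f p -> derivable h (f p) 1 ->
  'D_v (h \o f) p = derive1 h (f p) * 'D_v f p.
Proof.
move=> df /[dup] dh /derivable1_diffP dh'.
rewrite deriveE; last exact: differentiable_comp.
by rewrite diff_comp // deriveE //= deriv1E //= mulrC.
Qed.

Lemma Ck_comp n A (J : set R) (h : R -> R) f : open A ->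
  (forall p, A p -> J (f p)) -> Ck n J h -> Ck n A f -> Ck n A (h \o f).
Proof.
move=> oA AJ; elim: n h => [//|n IH] h Ch Cf; split=> [p Ap|v].
  apply: differentiable_comp; first exact: Ck_diff Cf Ap.
  exact: Ck_diff Ch (AJ _ Ap).
have CD := IH _ (Ch.2 1) (CkW Cf).
apply: Ck_eq (CkM oA CD (Cf.2 v)) => // p Ap.
rewrite derive_comp_real /= ?derive1E//; first exact: Ck_diff Cf Ap.
apply/diff_derivable; exact: Ck_diff Ch (AJ _ Ap).
Qed.

End Ck_scalar.

Section Ck_smooth.
Context (R : realType).

Lemma smooth_onP (E V : normedModType R) (A : set E) (f : E -> V) :
  smooth_on A f <-> forall n, Ck n A f.
Proof.
split=> [|Cf vs].
  move=> + n; elim: n f => [//|n IH] f sf; split=> [p|v].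
    exact: (sf [::]).
  (* [foldr] applies the last direction of the list first, so starting with the derivative along [v]
     means appending [v] at the end. *)
  apply: IH => vs p Ap; have := sf (rcons vs v) p Ap.
  by rewrite -cats1 foldr_cat.
suff : forall n, Ck n A (foldr (fun v g => 'D_v g) f vs).
  by move=> /(_ 1%N) C p Ap; exact: Ck_diff C Ap.
elim: vs => [|v vs IH] n; first exact: Cf.
by have [_] := IH n.+1; apply.
Qed.

(** On the line, the derivative along [v] is [v] times the ordinary derivative, so iterated ordinary
    derivatives control all directional ones. *)
Lemma smooth_curveP (V : normedModType R) (J : set R) (f : R -> V) : open J ->
  smooth_curve J f <-> forall n, Ck n J f.
Proof.
move=> oJ; split=> [|Cf n s Js].
  move=> + n; elim: n f => [//|n IH] f sf; split=> [p Jp|v].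
    by apply/derivable1_diffP; exact: (sf 0).
  have sf' : smooth_curve J f^`().
    by move=> m s Js; rewrite -derive1Sn; exact: sf.
  apply: Ck_eq (CkZ v oJ (IH _ sf')) => // p Jp.
  have dfp : derivable f p 1 by exact: (sf 0).
  rewrite [RHS]deriveE; last exact/derivable1_diffP.
  by rewrite deriv1E.
have : Ck 1%N J f^`(n).
  have : Ck n.+1 J f by [].
  elim: n f {Cf} => [//|n IH] f Cf; rewrite derive1Sn; apply: IH.
  have C : Ck n.+1 J ('D_1 f) := Cf.2 1.
  by apply: Ck_eq C => // p _; rewrite derive1E.
by move=> C; apply/derivable1_diffP; exact: Ck_diff C Js.
Qed.

End Ck_smooth.

(** * A smooth implicit function theorem *)

Lemma Ck_derive1 (R : realType) (V : normedModType R) (J : set R) (f : R -> V) :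
  open J -> (forall n, Ck n J f) -> forall n, Ck n J f^`().
Proof.
move=> oJ Cf n; apply: Ck_eq ((Cf n.+1).2 1) => // p _.
by rewrite derive1E.
Qed.

Lemma continuous_bigsum (R : realType) (T : topologicalType) (J : Type)
    (r : seq J) (f : J -> T -> R) (x : T) :
  (forall j, continuous_at x (f j)) ->
  continuous_at x (fun t => \sum_(j <- r) f j t).
Proof.
move=> cf; elim: r => [|j r IH].
  rewrite (_ : (fun t => _) = cst 0); first exact: cst_continuous.
  by apply/funext => t; rewrite big_nil.
rewrite (_ : (fun t => _) = f j \+ fun t => \sum_(j <- r) f j t); last first.
  by apply/funext => t; rewrite big_cons.
by apply: continuousD; [exact: cf|exact: IH].
Qed.

(** The linear form with coefficients [b]. As a canonical linear map it can serve as a differential;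
    it is used for coordinates, for the parameter part of the implicit equation and for components
    in an affine frame. *)
Definition lincomb (R : realType) (n : nat) (b : 'I_n -> R) (w : 'rV[R]_n)
    : R :=
  \sum_i w 0 i * b i.

Section lincomb_linear.
Context (R : realType) (n : nat) (b : 'I_n -> R).

Lemma lincomb_is_linear : linear (lincomb b).
Proof.
move=> k u v; rewrite /lincomb scaler_sumr -big_split /=; apply: eq_bigr => i _.
by rewrite !mxE mulrDl scalerAl.
Qed.

HB.instance Definition _ := GRing.isLinear.Build R 'rV[R]_n R _ (lincomb b)
  lincomb_is_linear.

Lemma lincomb_continuous : continuous (lincomb b : 'rV[R]_n -> R).
Proof.
move=> w; apply: continuous_bigsum => i.
apply: continuousM; last exact: cst_continuous.
exact: coord_continuous.
Qed.

End lincomb_linear.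

Lemma coord_lincomb (R : realType) (n : nat) (i : 'I_n) :
  (fun w : 'rV[R]_n => w 0 i) = lincomb (fun j => (j == i)%:R).
Proof.
apply/funext => w; rewrite /lincomb (bigD1 i) //= eqxx mulr1 big1 ?addr0 //.
by move=> j /negPf ->; rewrite mulr0.
Qed.

Lemma derive_coord (R : realType) (n : nat) (i : 'I_n) (w v : 'rV[R]_n) :
  'D_v (fun w : 'rV[R]_n => w 0 i) w = v 0 i.
Proof.
have -> : v 0 i = lincomb (fun j => (j == i)%:R) v by rewrite -coord_lincomb.
rewrite coord_lincomb deriveE.
  by rewrite diff_lin //; exact: lincomb_continuous.
by apply: linear_differentiable; exact: lincomb_continuous.
Qed.

Lemma Ck_coord (R : realType) (n k : nat) (A : set 'rV[R]_n) (i : 'I_n) :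
  Ck k A (fun w : 'rV[R]_n => w 0 i).
Proof.
by rewrite coord_lincomb; apply: Ck_linear; exact: lincomb_continuous.
Qed.

Section implicit.
Context (R : realType) (n : nat).
Variables (I : set R) (a : R -> R) (b : 'I_n -> R -> R) (u0 : R).
Hypothesis oI : open I.
Hypothesis Iu0 : I u0.
Hypothesis Ca : forall k, Ck k I a.
Hypothesis Cb : forall k i, Ck k I (b i).
Hypothesis a0 : a u0 = 0.
Hypothesis da0 : 0 < derive1 a u0.

Let Phi (w : 'rV[R]_n) u := a u + lincomb (b ^~ u) w.
Let dPhi (w : 'rV[R]_n) u := derive1 a u + lincomb (fun i => derive1 (b i) u) w.

Let Phi_derive w u : I u -> is_derive u 1 (Phi w) (dPhi w u).
Proof.
move=> Iu.
have D f : Ck 1%N I f -> is_derive u 1 f (derive1 f u).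
  by move=> Cf; rewrite derive1E; apply/derivableP/diff_derivable/(Ck_diff Cf).
apply: is_deriveD; first exact: D.
rewrite (_ : (fun u => lincomb _ _) = \sum_i (w 0 i *: b i)); last first.
  by apply/funext => v; rewrite fct_sumE.
by apply: is_derive_sum => i; apply: is_deriveZ; exact: D.
Qed.

Let dPhi_continuous w u : I u ->
  {for (u, w), continuous (fun z : R * 'rV[R]_n => dPhi z.2 z.1)}.
Proof.
move=> Iu.
have C (f : R -> R) : (forall k, Ck k I f) ->
    {for (u, w), continuous (fun z : R * 'rV[R]_n => derive1 f z.1)}.
  move=> Cf; apply: (@continuous_comp _ _ _ fst (derive1 f)).
    exact: cvg_fst.
  exact/differentiable_continuous/(Ck_diff (Ck_derive1 oI Cf 1%N)).
apply: continuousD; first exact: C.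
apply: continuous_bigsum => i.
apply: (@continuousM _ _ (fun z : R * 'rV[R]_n => z.2 0 i)
  (fun z => derive1 (b i) z.1)); last exact: C.
apply: (@continuous_comp _ _ _ snd (fun w : 'rV[R]_n => w 0 i)).
  exact: cvg_snd.
exact: coord_continuous.
Qed.

(** The equation a(u) + sum_i w_i b_i(u) = 0 is affine in the parameter w. Its derivative in u stays
    positive near (u0, 0), so the intermediate value theorem gives a root and the mean value theorem
    its uniqueness. The root has partial derivatives -b_i(phi) / [dPhi](phi); since these are smooth
    expressions in phi itself, each order of smoothness of phi yields the next. *)
Lemma implicit_function : exists (r d : R) (phi : 'rV[R]_n -> R),
  [/\ 0 < r, 0 < d, ball u0 r `<=` I,
      forall w : 'rV[R]_n, ball 0 d w ->
        ball u0 r (phi w) /\ Phi w (phi w) = 0 &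
      forall (w : 'rV[R]_n) (u : R), ball 0 d w -> ball u0 r u ->
        Phi w u = 0 -> u = phi w] /\
  (forall k, Ck k (ball 0 d) phi).
Proof.
have Phi0 u : Phi 0 u = a u by rewrite /Phi linear0 addr0.
have dPhi0 : dPhi 0 u0 = derive1 a u0 by rewrite /dPhi linear0 addr0.
(* Half the slope at the base point bounds the slope from below on a whole neighbourhood, which
   keeps all later quotients under control. *)
set m := derive1 a u0 / 2; have m0 : 0 < m by rewrite divr_gt0.
have half_lt (x : R) : 0 < x -> x / 2 < x by lra.
have [e e0 He] : exists2 e, 0 < e & forall (u : R) (w : 'rV[R]_n),
    ball u0 e u -> ball 0 e w -> I u /\ m < dPhi w u.
  have : \forall z \near (u0, 0 : 'rV[R]_n), I z.1 /\ m < dPhi z.2 z.1.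
    near=> z; split; near: z.
      apply: cvg_fst; exact: open_nbhs_nbhs.
    apply: (cvgr_gt _ (dPhi_continuous (w := 0) Iu0)) => /=.
    by rewrite dPhi0; exact: half_lt.
  move=> /nbhs_ballP[e /= e0 He]; exists e => // u w bu bw.
  by apply: (He (u, w)).
(* The mean value theorem in u for fixed w, with the two points in either order. The bound on [c] is
   what later makes it converge to [u1] as [u2] does. *)
have MV (w : 'rV[R]_n) (u1 u2 : R) :
    ball 0 e w -> ball u0 e u1 -> ball u0 e u2 ->
    exists2 c, `|c - u1| <= `|u2 - u1| /\ ball u0 e c &
      Phi w u2 - Phi w u1 = dPhi w c * (u2 - u1).
  move=> bw.
  have main v1 v2 : v1 <= v2 -> ball u0 e v1 -> ball u0 e v2 ->
      exists2 c, v1 <= c <= v2 /\ ball u0 e c &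
        Phi w v2 - Phi w v1 = dPhi w c * (v2 - v1).
    move=> v12 b1 b2.
    have bI c : v1 <= c <= v2 -> ball u0 e c.
      move: b1 b2; rewrite /ball /= !ltr_distlC.
      move=> /andP[? ?] /andP[? ?] /andP[? ?].
      by apply/andP; split; lra.
    have [||c] := @MVT_segment _ (Phi w) (dPhi w) v1 v2 v12.
    - move=> x; rewrite in_itv /= => /andP[x1 x2]; apply: Phi_derive.
      by apply: (He x w _ bw).1; apply: bI; rewrite !ltW.
    - apply: derivable_within_continuous => x; rewrite in_itv /= => xI.
      by have [] := Phi_derive w (He x w (bI _ xI) bw).1.
    by rewrite in_itv /= => cI ->; exists c => //; split=> //; exact: bI.
  move=> b1 b2; have [u12|/ltW u21] := leP u1 u2.
    have [c [/andP[c1 c2] bc] Ec] := main _ _ u12 b1 b2.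
    exists c; last exact: Ec.
    by split=> //; rewrite !ger0_norm ?subr_ge0 ?lerD2r.
  have [c [/andP[c1 c2] bc] Ec] := main _ _ u21 b2 b1.
  exists c; last by rewrite -[LHS]opprB Ec -mulrN opprB.
  by split=> //; rewrite !ler0_norm ?subr_le0 ?lerN2 ?lerD2r.
(* Halving keeps the endpoints u0 - r and u0 + r, where the sign change is read off, inside the ball
   of radius [e]. *)
set r := e / 2; have r0 : 0 < r by rewrite divr_gt0.
have re : r < e by exact: half_lt.
have re_sub (u : R) : ball u0 r u -> ball u0 e u.
  by apply: le_ball; exact: ltW.
have buz : ball u0 e u0 by exact: ballxx.
have bup : ball u0 e (u0 + r).
  by rewrite /ball /= opprD addNKr normrN gtr0_norm.
have bum : ball u0 e (u0 - r).
  by rewrite /ball /= opprB addrC subrK gtr0_norm.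
have bw0 : ball 0 e (0 : 'rV[R]_n) by exact: ballxx.
have Pp : 0 < Phi 0 (u0 + r).
  have [c [_ bc]] := MV 0 _ _ bw0 buz bup.
  rewrite !Phi0 a0 subr0 addrAC subrr add0r => ->.
  by rewrite mulr_gt0 // (lt_trans m0) //; exact: (He c 0 bc bw0).2.
have Pm : Phi 0 (u0 - r) < 0.
  have [c [_ bc]] := MV 0 _ _ bw0 buz bum.
  rewrite !Phi0 a0 subr0 addrAC subrr add0r => ->.
  rewrite mulrN oppr_lt0 mulr_gt0 // (lt_trans m0) //.
  exact: (He c 0 bc bw0).2.
have Pc (u : R) : continuous_at (0 : 'rV[R]_n) (Phi ^~ u).
  by apply: continuousD; [exact: cst_continuous|exact: lincomb_continuous].
have [d d0 Hd] : exists2 d, 0 < d & forall w : 'rV[R]_n, ball 0 d w ->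
    [/\ ball 0 e w, 0 < Phi w (u0 + r) & Phi w (u0 - r) < 0].
  have : \forall w \near (0 : 'rV[R]_n),
      [/\ ball 0 e w, 0 < Phi w (u0 + r) & Phi w (u0 - r) < 0].
    near=> w; split; near: w.
    - exact: nbhsx_ballx.
    - exact: (cvgr_gt _ (Pc (u0 + r))).
    - exact: (cvgr_lt _ (Pc (u0 - r))).
  by move=> /nbhs_ballP[d /= d0 Hd]; exists d => // w /Hd.
have bde (w : 'rV[R]_n) : ball 0 d w -> ball 0 e w by move=> /Hd[].
have ex (w : 'rV[R]_n) : ball 0 d w ->
    exists u : R, [set u | ball u0 r u /\ Phi w u = 0] u.
  move=> /Hd[bw p1 p2].
  have [|||u] := @IVT _ (Phi w) (u0 - r) (u0 + r) 0.
  - lra.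
  - apply: derivable_within_continuous => x; rewrite in_itv /= => /andP[x1 x2].
    have bx : ball u0 e x.
      by rewrite /ball /= ltr_distlC; apply/andP; split; lra.
    by have [] := Phi_derive w (He x w bx bw).1.
  - by rewrite ge_min le_max (ltW p1) (ltW p2) orbT.
  rewrite in_itv /= => /andP[u1 u2] Pu; exists u; split=> //=.
  rewrite /ball /= ltr_distlC !lt_neqAle u1 u2 !andbT; apply/andP; split.
    by apply/eqP => Eu; rewrite Eu Pu ltxx in p2.
  by apply/eqP => Eu; rewrite -Eu Pu ltxx in p1.
(* The default value [u0] is taken only where there is no root, hence never on the ball of radius
   [d]. *)
pose phi w := xget u0 [set u | ball u0 r u /\ Phi w u = 0].
have phiP (w : 'rV[R]_n) : ball 0 d w -> ball u0 r (phi w) /\ Phi w (phi w) = 0.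
  by move=> /ex exw; exact: (xgetPex u0 exw).
have dpos (w : 'rV[R]_n) (c : R) : ball 0 d w -> ball u0 e c -> m < dPhi w c.
  by move=> /Hd[bw _ _] bc; exact: (He c w bc bw).2.
have uniq (w : 'rV[R]_n) (u : R) : ball 0 d w -> ball u0 r u -> Phi w u = 0 ->
    u = phi w.
  move=> bw bu Pu; have [bp Pp0] := phiP w bw.
  have [c [_ bc]] := MV w u (phi w) (bde _ bw) (re_sub _ bu) (re_sub _ bp).
  rewrite Pu Pp0 subrr => /esym/eqP; rewrite mulf_eq0 subr_eq0.
  by rewrite gt_eqF ?(lt_trans m0 (dpos _ _ bw bc)) //= => /eqP.
have diff (w : 'rV[R]_n) : ball 0 d w -> differentiable phi w /\
    'd phi w = lincomb (fun i => - (b i (phi w) / dPhi w (phi w)))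
      :> ('rV[R]_n -> R).
  move=> bw; apply: linear_approx_diff; first exact: lincomb_continuous.
  have [bp Pp0] := phiP w bw.
  set S := lincomb (b ^~ (phi w)); set D := dPhi w (phi w).
  have mD : m < D by apply: dpos => //; exact: re_sub.
  have LE h : lincomb (fun i => - (b i (phi w) / D)) h = - (S h / D).
    rewrite /S /lincomb mulr_suml -sumrN; apply: eq_bigr => i _.
    by rewrite mulrN mulrA.
  have [k k0 Sk] := linear_lipschitz (lincomb_continuous (b := b ^~ (phi w))).
  (* Both [phi w] and [phi (h + w)] are roots for their parameters: at the old root the shift of the
     parameter by [h] contributes exactly [S h], and the move to the new root has to cancel it. *)
  have step h : ball 0 d (h + w) -> exists2 c : R,
      `|c - phi w| <= `|phi (h + w) - phi w| /\ ball u0 e c &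
      dPhi (h + w) c * (phi (h + w) - phi w) = - S h.
    move=> bhw; have [bp' Pp0'] := phiP _ bhw.
    have [c Hc E] := MV (h + w) (phi w) (phi (h + w)) (bde _ bhw)
      (re_sub _ bp) (re_sub _ bp').
    exists c; first exact: Hc.
    rewrite -E Pp0' sub0r; congr (- _).
    by rewrite /Phi linearD /= addrCA [X in _ + X](Pp0 : _ = 0) addr0.
  (* The error of the linear approximation is S h (d' - D) / (d' D), with |S h| <= k |h| and d', D >
     m. Thus |D - d'| <= [eta] gives the error bound eps |h|. *)
  move=> eps eps0; set eta := eps * m * m / k.
  have eta0 : 0 < eta by rewrite divr_gt0 // !mulr_gt0.
  have Iw : I (phi w) by exact: (He _ 0 (re_sub _ bp) bw0).1.
  have /cvgrPdist_le/(_ _ eta0)/nbhs_ballP[e1 /= e10 H1] :=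
    dPhi_continuous (w := w) Iw.
  have nw : \forall h \near (0 : 'rV[R]_n), ball 0 d (h + w).
    have : \forall u \near w, ball 0 d u.
      by apply: open_nbhs_nbhs; split=> //; exact: ball_open.
    by rewrite (near_shift 0) /=; apply: filterS => h /=; rewrite subr0.
  near=> h.
  have bhw : ball 0 d (h + w) by near: h.
  have h1 : `|h| < e1 by near: h; exact: (@nbhs0_lt R 'rV[R]_n).
  (* The root moves by at most k |h| / m, hence here by less than [e1]. *)
  have h2 : `|h| < e1 * m / k.
    by near: h; apply: (@nbhs0_lt R 'rV[R]_n); rewrite divr_gt0 // mulr_gt0.
  have [c [cp bc] Ec] := step h bhw.
  have md' := dpos _ _ bhw bc; set d' := dPhi (h + w) c in Ec md'.
  set x := phi (h + w) - phi w in cp Ec *.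
  have d'0 : 0 < d' by exact: lt_trans md'.
  have D0 : 0 < D by exact: lt_trans mD.
  have xE : x = - S h / d' by rewrite -Ec mulrAC divff ?mul1r// gt_eqF.
  have xle : `|x| <= k * `|h| / m.
    rewrite xE normrM normrN normfV (gtr0_norm d'0).
    apply: ler_pM => //; first by rewrite invr_ge0 ltW.
    by rewrite lef_pV2 ?posrE // ltW.
  have Dd' : `|D - d'| <= eta.
    apply: (H1 (c, h + w)); split => /=.
      rewrite /ball /= distrC (le_lt_trans cp) // (le_lt_trans xle) //.
      by rewrite ltr_pdivrMr // mulrC -ltr_pdivlMr.
    by rewrite -ball_normE /= opprD addrCA subrr addr0 normrN.
  rewrite LE opprK xE.
  have -> : - S h / d' + S h / D = S h * ((d' - D) / (d' * D)).
    by field; rewrite !gt_eqF.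
  rewrite normrM (le_trans (ler_pM _ _ (Sk h) (_ : _ <= eta / (m * m)))) //.
    rewrite normrM normfV distrC [`|d' * D|]gtr0_norm ?mulr_gt0 //.
    apply: ler_pM => //; first by rewrite invr_ge0 mulr_ge0 // ltW.
    rewrite lef_pV2 ?posrE ?mulr_gt0 // ler_pM ?ltW //.
  rewrite le_eqVlt; apply/orP; left; apply/eqP; rewrite /eta; field.
  by rewrite !gt_eqF.
have oB : open (ball (0 : 'rV[R]_n) d) by exact: ball_open.
have phiI w : ball 0 d w -> I (phi w).
  by move=> /phiP[/re_sub bp _]; exact: (He _ 0 bp bw0).1.
have phiD w v : ball 0 d w ->
    'D_v phi w = \sum_i v 0 i * - (b i (phi w) / dPhi w (phi w)).
  by move=> /diff[df dE]; rewrite deriveE // dE.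
have phiC k : Ck k (ball 0 d) phi.
  elim: k => [//|k IH]; split=> [w /diff[]//|v].
  have CI (f : R -> R) : (forall k, Ck k I f) -> Ck k (ball 0 d) (f \o phi).
    by move=> Cf; exact: Ck_comp oB phiI (Cf k) IH.
  have Ci i : Ck k (ball 0 d)
      (fun w => v 0 i * - (b i (phi w) / dPhi w (phi w))).
    apply: CkM => //; first exact: Ck_cst.
    apply: CkN => //; apply: CkM => //; first exact: (CI (b i)).
    apply: CkV => // [w bw|].
      rewrite gt_eqF // (lt_trans m0) // dpos //.
      by apply: re_sub; exact: (phiP _ bw).1.
    apply: CkD => //; first exact: (CI (derive1 a) (Ck_derive1 oI Ca)).
    apply: Ck_sum => // j; apply: CkM => //; first exact: Ck_coord.
    exact: (CI (derive1 (b j)) (Ck_derive1 oI (Cb^~ j))).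
  by apply: Ck_eq (Ck_sum _ _ oB Ci) => // w bw; rewrite phiD.
exists r, d, phi; split=> //; split=> // u /re_sub bu.
exact: (He u 0 bu bw0).1.
Unshelve. all: by end_near.
Qed.
End implicit.

(** * Monge form of a ruled surface *)

Lemma ord4_ind (Q : 'I_4 -> Prop) :
  Q 0 -> Q 1 -> Q 2%:R -> Q 3%:R -> forall i, Q i.
Proof.
move=> Q0 Q1 Q2 Q3 [[|[|[|[|//]]]] lti].
- by rewrite (_ : Ordinal lti = 0) //; exact: val_inj.
- by rewrite (_ : Ordinal lti = 1) //; exact: val_inj.
- by rewrite (_ : Ordinal lti = 2%:R) //; exact: val_inj.
- by rewrite (_ : Ordinal lti = 3%:R) //; exact: val_inj.
Qed.

Lemma ball_rV2 (R : realType) (d : R) (w : 'rV[R]_2) : 0 < d ->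
  ball 0 d w <-> `|w 0 0| < d /\ `|w 0 1| < d.
Proof.
move=> d0; split=> [[_ H]|[w0 w1]].
  have := H 0 0; have := H 0 1.
  by rewrite /ball /= !mxE !sub0r !normrN.
split=> // i [[|[|//]] ltj]; rewrite /ball /= mxE sub0r normrN ord1.
  by rewrite (_ : Ordinal ltj = 0) //; exact: val_inj.
by rewrite (_ : Ordinal ltj = 1) //; exact: val_inj.
Qed.

(* P + (t - t0) E is the surface in affine coordinates centred at (u0, t0) whose
   first three basis vectors are F_u, F_t = e and F_ut = e' at that point. *)
Section chart.
Context (R : realType).
Variables (I : set R) (P E : 'I_4 -> R -> R) (u0 t0 : R).
Hypothesis oI : open I.
Hypothesis Iu0 : I u0.
Hypothesis CP : forall k i, Ck k I (P i).
Hypothesis CE : forall k i, Ck k I (E i).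
Hypothesis P0 : forall i, P i u0 = 0.
Hypothesis dP0 : forall i, derive1 (P i) u0 = (i == 0 :> nat)%N%:R.
Hypothesis E0 : forall i, E i u0 = (i == 1 :> nat)%N%:R.
Hypothesis dE0 : forall i, derive1 (E i) u0 = (i == 2 :> nat)%N%:R.

Section jets.
Variables (V : set 'rV[R]_2) (phi tau : 'rV[R]_2 -> R).
Hypothesis oV : open V.
Hypothesis V0 : V 0.
Hypothesis Cphi : forall k, Ck k V phi.
Hypothesis Ctau : forall k, Ck k V tau.
Hypothesis phiI : forall w, V w -> I (phi w).
Hypothesis phi0 : phi 0 = u0.
Hypothesis tau0 : tau 0 = 0.

Let f i w := P i (phi w) + tau w * E i (phi w).

Hypothesis f0 : forall w, V w -> f 0 w = w 0 0.
Hypothesis f1 : forall w, V w -> f 1 w = w 0 1.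

Let Ck_derive (g : 'rV[R]_2 -> R) v : (forall k, Ck k V g) ->
  forall k, Ck k V ('D_v g).
Proof. by move=> Cg k; exact: (Cg k.+1).2. Qed.

Let is_derive_Ck (g : 'rV[R]_2 -> R) w v : (forall k, Ck k V g) -> V w ->
  is_derive w v g ('D_v g w).
Proof. by move=> Cg Vw; apply/derivableP/diff_derivable/(Ck_diff (Cg 1%N)). Qed.

Let is_derive_phi (h : R -> R) w v : (forall k, Ck k I h) -> V w ->
  is_derive w v (h \o phi) (derive1 h (phi w) * 'D_v phi w).
Proof.
move=> Ch Vw; have dphi := Ck_diff (Cphi 1%N) Vw.
have dh : differentiable h (phi w) by exact: Ck_diff (Ch 1%N) (phiI Vw).
rewrite -derive_comp_real //; last exact/derivable1_diffP.
apply/derivableP/diff_derivable; exact: differentiable_comp.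
Qed.

Let derive_graph i w v : V w ->
  'D_v (f i) w = (derive1 (P i) (phi w) + tau w * derive1 (E i) (phi w)) *
    'D_v phi w + E i (phi w) * 'D_v tau w.
Proof.
move=> Vw.
have H1 := is_derive_phi v (CP^~ i) Vw; have H2 := is_derive_phi v (CE^~ i) Vw.
have H3 := is_derive_Ck v Ctau Vw.
have [_ fD] := is_deriveD H1 (is_deriveM H3 H2).
rewrite [LHS]fD /GRing.scale /=; ring.
Qed.

Let derive_phi0 v : 'D_v phi 0 = v 0 0.
Proof.
rewrite -[RHS](derive_coord 0 0).
have <- : 'D_v (f 0) 0 = 'D_v (fun w : 'rV[R]_2 => w 0 0) 0.
  apply: near_eq_derive.
  by apply: filterS (open_nbhs_nbhs (conj oV V0)) => w /f0.
by rewrite derive_graph // phi0 tau0 dP0 E0 /= !mul0r !addr0 mul1r.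
Qed.

Let derive_tau0 v : 'D_v tau 0 = v 0 1.
Proof.
rewrite -[RHS](derive_coord 1 0).
have <- : 'D_v (f 1) 0 = 'D_v (fun w : 'rV[R]_2 => w 0 1) 0.
  apply: near_eq_derive.
  by apply: filterS (open_nbhs_nbhs (conj oV V0)) => w /f1.
by rewrite derive_graph // phi0 tau0 dP0 E0 /= !mul0r !add0r mul0r add0r mul1r.
Qed.

Lemma derive_graph0 (i : 'I_4) v : (1 < i)%N -> 'D_v (f i) 0 = 0.
Proof.
move=> i1; rewrite derive_graph // phi0 tau0 dP0 E0.
rewrite (gtn_eqF i1) (gtn_eqF (ltnW i1)) /=.
by rewrite !mul0r !addr0 mul0r.
Qed.

(** The second derivatives of [phi] and [tau] drop out: they are multiplied by P_i'(u0) and E_i(u0),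
    which vanish for i > 1. The first derivatives of [phi] and [tau] at 0 are the two coordinates of
    the direction. *)
Lemma derive2_graph0 (i : 'I_4) v v' : (1 < i)%N ->
  'D_v' ('D_v (f i)) 0 = derive1 (derive1 (P i)) u0 * v 0 0 * v' 0 0 +
    (i == 2 :> nat)%N%:R * (v' 0 1 * v 0 0 + v' 0 0 * v 0 1).
Proof.
move=> i1.
have -> : 'D_v' ('D_v (f i)) 0 =
    'D_v' (((derive1 (P i) \o phi) + tau * (derive1 (E i) \o phi)) * 'D_v phi +
      (E i \o phi) * 'D_v tau) 0.
  apply: near_eq_derive; apply: filterS (open_nbhs_nbhs (conj oV V0)) => w Vw.
  by rewrite derive_graph.
have H1 := is_derive_phi v' (Ck_derive1 oI (CP^~ i)) V0.
have H2 := is_derive_phi v' (Ck_derive1 oI (CE^~ i)) V0.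
have H3 := is_derive_phi v' (CE^~ i) V0.
have H4 := is_derive_Ck v' Ctau V0.
have H5 := is_derive_Ck v' (Ck_derive v Cphi) V0.
have H6 := is_derive_Ck v' (Ck_derive v Ctau) V0.
have [_ ->] := is_deriveD (is_deriveM (is_deriveD H1 (is_deriveM H4 H2)) H5)
  (is_deriveM H3 H6).
have -> : (derive1 (P i) \o phi + tau * (derive1 (E i) \o phi)) 0 =
  derive1 (P i) (phi 0) + tau 0 * derive1 (E i) (phi 0) by [].
rewrite /GRing.scale /= !derive_phi0 !derive_tau0 tau0 phi0 dP0 dE0 E0.
rewrite (gtn_eqF i1) (gtn_eqF (ltnW i1)) /=.
have gen (p q k a b c d x y : R) :
  (0 + 0 * k) * x + a * (p * c + (0 * (q * c) + k * d)) +
  (0 * y + b * (k * c)) = p * a * c + k * (d * a + c * b) by ring.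
exact: gen.
Qed.

End jets.

Hypothesis ddP0 : derive1 (derive1 (P 3%:R)) u0 = 0.

(** Since F_u and F_t are the first two axes, the parameters can be recovered from the first two
    coordinates near the base point, and the other two coordinates become [f1] and [f2]. The term xy
    of [f1] comes from F_ut being the third axis; the 2-jet of [f2] vanishes because F_uu has no
    fourth component. *)
Lemma ruled_graph : exists (U : set (R * R)) (V : set 'rV[R]_2)
    (f1 f2 : 'rV[R]_2 -> R),
  [/\ open V, V 0, smooth_on V f1 & smooth_on V f2] /\
  [/\ open U, U (u0, t0), U `<=` I `*` setT
    & [set \row_i (P i z.1 + (z.2 - t0) * E i z.1) | z in U] =
      [set \row_(i < 4) [:: w 0 0; w 0 1; f1 w; f2 w]`_i | w in V]] /\
  quadratic_2jet f1 (derive1 (derive1 (P 2%:R)) u0 / 2) (1 / 2) 0 /\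
  quadratic_2jet f2 0 0 0.
Proof.
have Cc (f : R -> R) (u : R) : I u -> (forall k, Ck k I f) -> continuous_at u f.
  by move=> Iu Cf; exact/differentiable_continuous/(Ck_diff (Cf 1%N)).
(* Where E_1 does not vanish, the second coordinate can be solved for tau. *)
have [rho rho0 Hrho] : exists2 rho, 0 < rho &
    forall u, ball u0 rho u -> I u /\ E 1 u != 0.
  have : \forall u \near u0, I u /\ E 1 u != 0.
    near=> u; split; near: u; first exact: open_nbhs_nbhs.
    have E1 : 0 < E 1 u0 by rewrite E0.
    by apply: filterS (cvgr_gt _ (Cc _ _ Iu0 (CE^~ 1)) _ E1) => u /gt_eqF ->.
  by move=> /nbhs_ballP[rho /= rho0 H]; exists rho.
have oB : open (ball u0 rho) by exact: ball_open.
have BI : ball u0 rho `<=` I by move=> u /Hrho[].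
have CPB k i : Ck k (ball u0 rho) (P i) by exact: Ck_subset BI (CP k i).
have CEB k i : Ck k (ball u0 rho) (E i) by exact: Ck_subset BI (CE k i).
(* Eliminating tau from w_j = P_j(u) + tau E_j(u), j = 0, 1, gives
   a(u) + w_0 b_0(u) + w_1 b_1(u) = 0. *)
pose a u := P 0 u * E 1 u - P 1 u * E 0 u.
pose b (i : 'I_2) u := if i == 0 then - E 1 u else E 0 u.
have Ca k : Ck k (ball u0 rho) a by apply: CkB => //; exact: CkM.
have Cb k i : Ck k (ball u0 rho) (b i).
  by rewrite /b; case: (i == 0) => //; exact: CkN.
have a0 : a u0 = 0 by rewrite /a !P0 !mul0r subrr.
have da0 : derive1 a u0 = 1.
  have D (f : R -> R) : (forall k, Ck k I f) -> is_derive u0 1 f (derive1 f u0).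
    move=> Cf; rewrite derive1E; apply/derivableP/diff_derivable.
    exact: Ck_diff (Cf 1%N) Iu0.
  have [_ aD] := is_deriveB (is_deriveM (D _ (CP^~ 0)) (D _ (CE^~ 1)))
    (is_deriveM (D _ (CP^~ 1)) (D _ (CE^~ 0))).
  rewrite derive1E [LHS]aD /GRing.scale /= !P0 !dP0 !E0 !dE0 /=.
  by rewrite !mul0r !mulr1 !add0r subr0.
have [|r [d [phi [[r0 d0 rI phiP phiU] Cphi]]]] :=
  implicit_function oB (ballxx _ rho0) Ca Cb a0.
  by rewrite da0.
have lincombE (w : 'rV[R]_2) u : a u + lincomb (b ^~ u) w =
    (P 0 u - w 0 0) * E 1 u - (P 1 u - w 0 1) * E 0 u.
  rewrite /a /b /lincomb !big_ord_recl big_ord0 /=.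
  rewrite (_ : lift ord0 ord0 = 1); last exact: val_inj.
  ring.
set V := ball (0 : 'rV[R]_2) d.
have oV : open V by exact: ball_open.
have V0 : V 0 by exact: ballxx.
have phiB w : V w -> ball u0 rho (phi w) by move=> /phiP[/rI].
have phiI w : V w -> I (phi w) by move=> /phiB/BI.
have phi0 : phi 0 = u0.
  apply/esym/phiU => //; first exact: ballxx.
  by rewrite linear0 addr0 a0.
pose tau (w : 'rV[R]_2) := (w 0 1 - P 1 (phi w)) / E 1 (phi w).
have Ccomp k (f : R -> R) : (forall k, Ck k I f) -> Ck k V (fun w => f (phi w)).
  by move=> Cf; exact: Ck_comp oV phiI (Cf k) (Cphi k).
have Ctau k : Ck k V tau.
  apply: CkM => //.
    by apply: CkB => //; [exact: Ck_coord|exact: (Ccomp _ _ (CP^~ 1))].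
  apply: CkV => //; last exact: (Ccomp _ _ (CE^~ 1)).
  by move=> w /phiB/Hrho[].
have tau0 : tau 0 = 0 by rewrite /tau mxE phi0 P0 subrr mul0r.
pose f (i : 'I_4) (w : 'rV[R]_2) := P i (phi w) + tau w * E i (phi w).
have Cf i : smooth_on V (f i).
  apply/smooth_onP => k; apply: CkD => //; first exact: (Ccomp _ _ (CP^~ i)).
  by apply: CkM => //; exact: (Ccomp _ _ (CE^~ i)).
have E1 w : V w -> E 1 (phi w) != 0 by move=> /phiB/Hrho[].
have f1E w : V w -> f 1 w = w 0 1.
  by move=> Vw; rewrite /f /tau; field; exact: E1.
have f0E w : V w -> f 0 w = w 0 0.
  move=> Vw; have := (phiP w Vw).2; rewrite lincombE => PE.
  apply: (mulIf (E1 w Vw)); apply/eqP; rewrite -subr_eq0 -PE; apply/eqP.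
  by rewrite /f /tau; field; exact: E1.
pose W (z : R * R) : 'rV[R]_4 := \row_i (P i z.1 + (z.2 - t0) * E i z.1).
pose w_ (z : R * R) : 'rV[R]_2 :=
  \row_(i < 2) if i == 0 then W z 0 0 else W z 0 1.
(* Restricting to the preimage of [V] makes the image exactly the graph over [V]: a point w is
   reached from (phi w, t0 + tau w), and conversely uniqueness of the root identifies z.1 with phi
   of the first two coordinates. *)
exists [set z | ball u0 r z.1 /\ V (w_ z)], V, (f 2%:R), (f 3%:R).
split; first by split.
split.
  split.
  - rewrite openE => z [br Vz].
    have cW i : continuous_at z
        (fun y : R * R => P i y.1 + (y.2 - t0) * E i y.1).
      have Iz : I z.1 by exact: BI (rI _ br).
      apply: cvgD.
        apply: (@continuous_comp _ _ _ fst (P i)); first exact: cvg_fst.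
        exact: Cc (CP^~ i).
      apply: cvgM.
        by apply: cvgB; [exact: cvg_snd|exact: cvg_cst].
      apply: (@continuous_comp _ _ _ fst (E i)); first exact: cvg_fst.
      exact: Cc (CE^~ i).
    have /(ball_rV2 _ d0)[] := Vz; rewrite !mxE /= => W0 W1.
    near=> y; split; near: y.
      by apply: cvg_fst; apply: open_nbhs_nbhs; split=> //; exact: ball_open.
    near=> y; apply/ball_rV2 => //; rewrite !mxE /=; split; near: y.
      exact: (cvgr_norm_lt _ (cW 0) _ W0).
    exact: (cvgr_norm_lt _ (cW 1) _ W1).
  - split; first exact: ballxx.
    rewrite /w_ (_ : \row__ _ = 0) //; apply/rowP => i; rewrite !mxE /=.
    by rewrite subrr !mul0r !addr0 !P0 if_same.
  - by move=> z [/rI/BI ? _]; split.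
  - rewrite eqEsubset; split => [_ [z [br Vz] <-]|_ [w Vw <-]].
    have w0 : w_ z 0 0 = P 0 z.1 + (z.2 - t0) * E 0 z.1 by rewrite !mxE.
    have w1 : w_ z 0 1 = P 1 z.1 + (z.2 - t0) * E 1 z.1 by rewrite !mxE.
    have zphi : z.1 = phi (w_ z).
      by apply: phiU => //; rewrite lincombE w0 w1; ring.
    have ztau : z.2 - t0 = tau (w_ z).
      rewrite /tau w1 -zphi; field; exact: (Hrho _ (rI _ br)).2.
    have fE i : P i z.1 + (z.2 - t0) * E i z.1 = f i (w_ z).
      by rewrite /f -ztau -zphi.
    exists (w_ z) => //; apply/rowP.
    apply: ord4_ind; rewrite [LHS]mxE [RHS]mxE fE //=.
      by rewrite f0E.
    by rewrite f1E.
  pose z := (phi w, t0 + tau w).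
  have zE i : P i z.1 + (z.2 - t0) * E i z.1 = f i w.
    by rewrite /z /= addrAC subrr add0r.
  exists z.
    split; first by have [] := phiP w Vw.
    rewrite (_ : w_ z = w) //.
    apply/rowP => -[[|[|//]] lti]; rewrite !mxE /= zE.
      by rewrite f0E // (_ : Ordinal lti = 0) //; exact: val_inj.
    by rewrite f1E // (_ : Ordinal lti = 1) //; exact: val_inj.
  apply/rowP; apply: ord4_ind; rewrite !mxE zE //=.
    by rewrite f0E.
  by rewrite f1E.
have fz (i : 'I_4) : (1 < i)%N -> f i 0 = 0.
  by move=> _; rewrite /f phi0 tau0 P0 mul0r addr0.
have Df (i : 'I_4) v : (1 < i)%N -> 'D_v (f i) 0 = 0.
  exact: (derive_graph0 V0 Cphi Ctau phiI phi0 tau0 v).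
have D2f (i : 'I_4) v v' : (1 < i)%N -> 'D_v' ('D_v (f i)) 0 =
    derive1 (derive1 (P i)) u0 * v 0 0 * v' 0 0 +
    (i == 2 :> nat)%N%:R * (v' 0 1 * v 0 0 + v' 0 0 * v 0 1).
  exact: (derive2_graph0 oV V0 Cphi Ctau phiI phi0 tau0 f0E f1E v v').
split; split; split; rewrite ?fz ?Df ?D2f //= ?ddP0 !mxE /=; field.
Unshelve. all: by end_near.
Qed.
End chart.

(** * A criterion for inflection points of real type *)

Section linear_comp.
Context (R : realType) (E V W : normedModType R) (L : {linear V -> W}).
Hypothesis cL : continuous L.

Lemma derive_linear_comp (f : E -> V) p v : differentiable f p ->
  'D_v (L \o f) p = L ('D_v f p).
Proof.
move=> df; have dL q : differentiable L q by exact: linear_differentiable.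
rewrite !deriveE //; last exact: differentiable_comp.
by rewrite diff_comp //= diff_lin.
Qed.

Lemma Ck_linear_comp k (A : set E) (f : E -> V) : open A ->
  Ck k A f -> Ck k A (L \o f).
Proof.
move=> oA; elim: k f => [//|k IH] f Cf; split=> [p Ap|v].
  apply: differentiable_comp; first exact: Ck_diff Cf Ap.
  exact: linear_differentiable.
apply: Ck_eq (IH _ (Cf.2 v)) => // p Ap.
by rewrite derive_linear_comp //; exact: Ck_diff Cf Ap.
Qed.

End linear_comp.

Lemma Ck_lincomb (R : realType) (E : normedModType R) (n k : nat) (A : set E)
    (b : 'I_n -> R) (f : E -> 'rV[R]_n) : open A -> Ck k A f ->
  Ck k A (fun p => lincomb b (f p)).
Proof. by apply: Ck_linear_comp; exact: lincomb_continuous. Qed.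

Lemma derive1_lincomb (R : realType) (n : nat) (b : 'I_n -> R)
    (f : R -> 'rV[R]_n) (u : R) : differentiable f u ->
  derive1 (fun s => lincomb b (f s)) u = lincomb b (derive1 f u).
Proof.
move=> df; rewrite !derive1E -derive_linear_comp //.
exact: lincomb_continuous.
Qed.

Section derive1_facts.
Context (R : realType) (V : normedModType R).
Implicit Types (f h k : R -> V) (A : set R) (u t : R).

Lemma is_derive_derive1 f u : differentiable f u ->
  is_derive u 1 f (derive1 f u).
Proof. by move=> df; rewrite derive1E; apply/derivableP/diff_derivable. Qed.

Lemma derive1DZ h k t u : differentiable h u -> differentiable k u ->
  derive1 (fun s => h s + t *: k s) u = derive1 h u + t *: derive1 k u.
Proof.
move=> /is_derive_derive1 dh /is_derive_derive1 dk.
by have [_ H] := is_deriveD dh (is_deriveZ t dk); rewrite derive1E [LHS]H.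
Qed.

Lemma derive1_subc h (c : V) u : differentiable h u ->
  derive1 (fun s => h s - c) u = derive1 h u.
Proof.
move=> /is_derive_derive1 dh.
have [_ H] := is_deriveB dh (is_derive_cst c u 1).
by rewrite derive1E [LHS]H subr0.
Qed.

Lemma eq_derive1 A f h u : open A -> A u -> (forall s, A s -> f s = h s) ->
  derive1 f u = derive1 h u.
Proof.
move=> oA Au fh; rewrite !derive1E; apply: near_eq_derive.
exact: filterS fh (open_nbhs_nbhs (conj oA Au)).
Qed.

End derive1_facts.

(** Independence of four vectors is expressed as invertibility of this matrix; its inverse then
    gives the coordinates in the frame they form. *)
Definition rows4 (R : fieldType) (a b c d : 'rV[R]_4) : 'M[R]_4 :=
  \matrix_(i < 4) [:: a; b; c; d]`_i.

Lemma mul_rows4 (R : fieldType) (y a b c d : 'rV[R]_4) :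
  y *m rows4 a b c d =
    y 0 0 *: a + y 0 1 *: b + y 0 2%:R *: c + y 0 3%:R *: d.
Proof.
rewrite mulmx_sum_row !big_ord_recl big_ord0 addr0 !rowK /= !addrA.
by congr (_ *: _ + _ *: _ + _ *: _ + _ *: _); congr (y 0 _); exact: val_inj.
Qed.

Lemma row_mul_invmx (R : fieldType) (n : nat) (N : 'M[R]_n) i :
  N \in unitmx -> row i N *m invmx N = delta_mx 0 i.
Proof. by move=> uN; rewrite rowE mulmxK. Qed.

(** One row is zero, and the other has the middle entry 1/2 whatever [l] is. *)
Lemma rank_inflection_matrix (R : realType) (l : R) :
  \rank (inflection_matrix l (1 / 2) 0 0 0 0) = 1%N.
Proof.
rewrite /inflection_matrix (_ : \row_(j < 3) [:: 0; 0; 0]`_j = 0); last first.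
  by apply/rowP => -[[|[|[|//]]] ltj]; rewrite !mxE.
rewrite rank_col_0mx rank_rV; case: eqP => // /rowP /(_ 1).
by rewrite !mxE /= => /eqP; rewrite mul1r invr_eq0 pnatr_eq0.
Qed.

Section criterion.
Context (R : realType) (I : set R) (g : ruled_data I).
Hypothesis oI : open I.
Variables (u0 t0 y0 y1 y2 : R).
Let x := rd_x g.
Let e := rd_e g.
Hypothesis Iu0 : I u0.
Hypothesis unitN :
  rows4 (derive1 x u0) (e u0) (derive1 e u0) (derive1 (derive1 e) u0)
    \in unitmx.
Hypothesis osc : derive1 (derive1 x) u0 + t0 *: derive1 (derive1 e) u0 =
  y0 *: derive1 x u0 + y1 *: e u0 + y2 *: derive1 e u0.

(** In the affine frame F_u, F_t = e, F_ut = e', e'' at the point, [osc] says that F_uu has no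
    component along e''. By [ruled_graph] the 2-jets are l x^2 + x y and 0, so the rank is 1 and K =
    -1/4. *)
Lemma real_inflection_criterion : real_inflection g u0 t0.
Proof.
have Cx k : Ck k I x by exact: (smooth_curveP x oI).1 (@rd_x_smooth _ _ g) k.
have Ce k : Ck k I e by exact: (smooth_curveP e oI).1 (@rd_e_smooth _ _ g) k.
pose N := rows4 (derive1 x u0 + t0 *: derive1 e u0) (e u0) (derive1 e u0)
  (derive1 (derive1 e) u0).
have N0 : row 0 N = derive1 x u0 + t0 *: derive1 e u0 by rewrite rowK.
have N1 : row 1 N = e u0 by rewrite rowK.
have N2 : row 2%:R N = derive1 e u0 by rewrite rowK.
have N3 : row 3%:R N = derive1 (derive1 e) u0 by rewrite rowK.
(* Passing from x' to F_u = x' + t0 e' is an elementary row operation. *)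
have uN : N \in unitmx.
  rewrite -row_full_unit -sub1mx.
  have := unitN; rewrite -row_full_unit -sub1mx => /submx_trans; apply.
  apply/row_subP; apply: ord4_ind; rewrite rowK /=.
  - rewrite -[derive1 x u0](addrK (t0 *: derive1 e u0)) -scaleNr.
    by rewrite -N0 -N2 addmx_sub ?scalemx_sub ?row_sub.
  - by rewrite -N1 row_sub.
  - by rewrite -N2 row_sub.
  - by rewrite -N3 row_sub.
pose M := invmx N.
(* Splitting F - F(u0, t0) as Q + (t - t0) e makes Q vanish at u0 with first derivative F_u(u0, t0),
   which is the first vector of the frame. *)
pose Q u := x u + t0 *: e u - ruled_map g u0 t0.
pose P i u := lincomb (M ^~ i) (Q u).
pose E i u := lincomb (M ^~ i) (e u).
have lM (v : 'rV[R]_4) i : lincomb (M ^~ i) v = (v *m M) 0 i by rewrite mxE.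
have eM : e u0 *m M = delta_mx 0 1 by rewrite -N1 row_mul_invmx.
have deM : derive1 e u0 *m M = delta_mx 0 2%:R.
  by rewrite -N2 row_mul_invmx.
have dxM : (derive1 x u0 + t0 *: derive1 e u0) *m M = delta_mx 0 0.
  by rewrite -N0 row_mul_invmx.
have CQ k : Ck k I Q.
  by apply: CkD; [|apply: CkD; [| |apply: CkZ]|exact: Ck_cst].
have CP k i : Ck k I (P i).
  exact: Ck_lincomb oI (CQ k).
have CE k i : Ck k I (E i).
  exact: Ck_lincomb oI (Ce k).
have dQ u : I u -> derive1 Q u = derive1 x u + t0 *: derive1 e u.
  move=> Iu; have dx := Ck_diff (Cx 1%N) Iu; have de := Ck_diff (Ce 1%N) Iu.
  rewrite -(derive1DZ t0 dx de); apply: derive1_subc.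
  exact: differentiableD dx (differentiableZ t0 de).
have ddQ : derive1 (derive1 Q) u0 =
    derive1 (derive1 x) u0 + t0 *: derive1 (derive1 e) u0.
  rewrite (eq_derive1 oI Iu0 dQ); apply: derive1DZ.
    exact: Ck_diff (Ck_derive1 oI Cx 1%N) Iu0.
  exact: Ck_diff (Ck_derive1 oI Ce 1%N) Iu0.
have P0 i : P i u0 = 0 by rewrite /P /Q subrr linear0.
have dP0 i : derive1 (P i) u0 = (i == 0 :> nat)%N%:R.
  rewrite derive1_lincomb; last exact: Ck_diff (CQ 1%N) Iu0.
  by rewrite (dQ u0 Iu0) lM dxM mxE eqxx.
have E0 i : E i u0 = (i == 1 :> nat)%N%:R by rewrite /E lM eM mxE eqxx.
have dE0 i : derive1 (E i) u0 = (i == 2 :> nat)%N%:R.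
  rewrite derive1_lincomb; last exact: Ck_diff (Ce 1%N) Iu0.
  by rewrite lM deM mxE eqxx.
have ddP0 : derive1 (derive1 (P 3%:R)) u0 = 0.
  have -> : derive1 (derive1 (P 3%:R)) u0 =
      derive1 (fun s => lincomb (M ^~ 3%:R) (derive1 Q s)) u0.
    apply: (eq_derive1 oI Iu0) => u Iu; apply: derive1_lincomb.
    exact: Ck_diff (CQ 1%N) Iu.
  rewrite derive1_lincomb; last exact: Ck_diff (Ck_derive1 oI CQ 1%N) Iu0.
  rewrite ddQ lM osc -[derive1 x u0](addrK (t0 *: derive1 e u0)).
  rewrite !mulmxDl -!scalemxAl mulmxBl -scalemxAl dxM eM deM !mxE /=.
  by rewrite !mulr0 subr0 !mulr0 !addr0.
have [U [V [f1 [f2 [[oV V0 sf1 sf2] [[oU U0 UI UV] [J1 J2]]]]]]] :=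
  ruled_graph t0 oI Iu0 CP CE P0 dP0 E0 dE0 ddP0.
exists M, V, f1, f2.
eexists; eexists; eexists; eexists; eexists; eexists; split.
- split.
    by split; [rewrite unitmx_inv|exact: oV|exact: V0|exact: sf1|exact: sf2].
  exists U; split; [exact: oU|exact: U0|exact: UI|].
  rewrite -UV; congr image; apply/funext => z; apply/rowP => i.
  have -> : ruled_map g z.1 z.2 - ruled_map g u0 t0 =
      Q z.1 + (z.2 - t0) *: e z.1.
    rewrite /Q [ruled_map g z.1 _]/ruled_map -/x -/e scalerBl.
    have shift (p q r s : 'rV[R]_4) : p + q - s = p + r - s + (q - r).
      by rewrite [RHS]addrC !addrA [q - r + p]addrAC subrK [q + p]addrC.
    exact: shift.
  by rewrite [RHS]mxE /P /E !lM mulmxDl -scalemxAl [LHS]mxE [X in _ + X]mxE.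
- exact: J1.
- exact: J2.
- exact: rank_inflection_matrix.
- have K (c : R) : 0 * 0 - 0 ^+ 2 + c * 0 - (1 / 2) ^+ 2 < 0 by lra.
  exact: K.
Qed.
End criterion.

(** * The inflection curve *)

Section matrix_curves.
Context (R : realType) (E : normedModType R) (A : set E) (k : nat).
Hypothesis oA : open A.

Lemma Ck_row_coord (n : nat) (f : E -> 'rV[R]_n) j :
  Ck k A f -> Ck k A (fun p => f p 0 j).
Proof.
move=> /(Ck_lincomb (fun l => (l == j)%:R) oA); apply: Ck_eq => // p _.
by rewrite -coord_lincomb.
Qed.

Lemma Ck_det (n : nat) (N : E -> 'M[R]_n) :
  (forall i j, Ck k A (fun p => N p i j)) -> Ck k A (fun p => \det (N p)).
Proof.
move=> CN; apply: Ck_sum => // s; apply: CkM => //; first exact: Ck_cst.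
by apply: Ck_prod => // i; exact: CN.
Qed.

Lemma Ck_cofactor (n : nat) (N : E -> 'M[R]_n) i j :
  (forall i j, Ck k A (fun p => N p i j)) ->
  Ck k A (fun p => cofactor (N p) i j).
Proof.
move=> CN; apply: CkM => //; first exact: Ck_cst.
apply: Ck_det => i' j'.
have C := CN (lift i i') (lift j j').
by apply: Ck_eq C => // p _; rewrite !mxE.
Qed.

Lemma Ck_rows4 (a b c d : E -> 'rV[R]_4) i j :
  Ck k A a -> Ck k A b -> Ck k A c -> Ck k A d ->
  Ck k A (fun p => rows4 (a p) (b p) (c p) (d p) i j).
Proof.
move=> Ca Cb Cc Cd.
have H (f : E -> 'rV[R]_4) : Ck k A f ->
    (forall p, f p = row i (rows4 (a p) (b p) (c p) (d p))) ->
    Ck k A (fun p => rows4 (a p) (b p) (c p) (d p) i j).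
  move=> /(@Ck_row_coord _ _ j) Cf fE; apply: Ck_eq Cf => // p _.
  by rewrite fE mxE.
move: i H; apply: ord4_ind => H.
- by apply: H Ca _ => p; rewrite rowK.
- by apply: H Cb _ => p; rewrite rowK.
- by apply: H Cc _ => p; rewrite rowK.
- by apply: H Cd _ => p; rewrite rowK.
Qed.

End matrix_curves.

(** Read entry by entry, this is the product rule for real functions. *)
Lemma is_derive_scale_row (R : realType) (n : nat) (t : R -> R)
    (f : R -> 'rV[R]_n) (s : R) : differentiable t s -> differentiable f s ->
  is_derive s 1 (fun r => t r *: f r) (t s *: derive1 f s + derive1 t s *: f s).
Proof.
move=> dt df.
have Dt : derivable t s 1 by exact: diff_derivable.
have Df : derivable f s 1 by exact: diff_derivable.
have Dij i j : derivable (fun r => f r i j) s 1.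
  exact: (derivable_mxP f s 1).1.
have coordE i j : (fun r => (t r *: f r) i j) = (fun r => t r * f r i j).
  by apply/funext => r; rewrite mxE.
have DM i j := is_deriveM (derivableP Dt) (derivableP (Dij i j)).
have D : derivable (fun r => t r *: f r) s 1.
  by apply/derivable_mxP => i j; rewrite coordE; have [DMij _] := DM i j.
apply: DeriveDef => //; rewrite derive_mx //; apply/matrixP => i j.
rewrite !derive1E (derive_mx Df) !mxE coordE.
by have [_ DMij] := DM i j; rewrite [LHS]DMij [f s i j *: _]mulrC.
Qed.

Section inflection_curve.
Context (R : realType) (I : set R) (g : ruled_data I).
Hypothesis oI : open I.
Hypothesis I0 : I 0.
Let x := rd_x g.
Let e := rd_e g.
Let N u := rows4 (derive1 x u) (e u) (derive1 e u) (derive1 (derive1 e) u).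
Hypothesis uN : N 0 \in unitmx.

Lemma inflection_curve : exists (J : set R) (u t : R -> R),
  [/\ regular_curve_on g J u t,
      forall s, J s -> real_inflection g (u s) (t s)
    & transverse_to_ruling g J u t 0].
Proof.
have Cx k : Ck k I x by exact: (smooth_curveP x oI).1 (@rd_x_smooth _ _ g) k.
have Ce k : Ck k I e by exact: (smooth_curveP e oI).1 (@rd_e_smooth _ _ g) k.
have Cdx := Ck_derive1 oI Cx; have Cde := Ck_derive1 oI Ce.
have Cddx := Ck_derive1 oI Cdx; have Cdde := Ck_derive1 oI Cde.
have CN k i j : Ck k I (fun u => N u i j).
  exact: (Ck_rows4 oI i j (Cdx k) (Ce k) (Cde k) (Cdde k)).
have Cdet k : Ck k I (fun u => \det (N u)).
  exact: (Ck_det (N := N) oI (CN k)).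
have [r r0 Hr] : exists2 r, 0 < r &
    forall u : R, ball 0 r u -> I u /\ N u \in unitmx.
  have : \forall u \near (0 : R), I u /\ \det (N u) != 0.
    near=> u; split; near: u; first exact: open_nbhs_nbhs.
    have c0 : continuous_at 0 (fun u => \det (N u)).
      exact/differentiable_continuous/(Ck_diff (Cdet 1%N)).
    by apply: (cvgr_neq0 _ c0); rewrite -unitfE -unitmxE.
  move=> /nbhs_ballP[r r0 H]; exists r; first exact: r0.
  move=> u /H[Iu dN]; split; first exact: Iu.
  rewrite unitmxE unitfE; exact: dN.
set J := ball (0 : R) r.
have oJ : open J by exact: ball_open.
have JI u : J u -> I u by move=> /Hr[].
have JN u : J u -> N u \in unitmx by move=> /Hr[].
(* By Cramer's rule, minus the coefficient of e'' when x'' is expanded in the frame x', e, e', e''.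
   Cofactors and determinant show that it depends smoothly on u. *)
pose t u := - (\sum_j derive1 (derive1 x) u 0 j * cofactor (N u) 3%:R j) /
  \det (N u).
have Ct k : Ck k J t.
  have CJ (f : R -> R) : Ck k I f -> Ck k J f by exact: Ck_subset.
  apply: CkM => //; last first.
    apply: CkV => //; last exact: CJ.
    by move=> u /JN; rewrite unitmxE unitfE.
  apply: CkN => //; apply: Ck_sum => // j; apply: CJ; apply: CkM => //.
    exact: (Ck_row_coord oI j (Cddx k)).
  exact: (Ck_cofactor (N := N) oI 3%:R j (CN k)).
have oscE u : J u -> exists y0 y1 y2,
    derive1 (derive1 x) u + t u *: derive1 (derive1 e) u =
    y0 *: derive1 x u + y1 *: e u + y2 *: derive1 e u.
  move=> /JN uNu; pose y := derive1 (derive1 x) u *m invmx (N u).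
  have xE : derive1 (derive1 x) u = y *m N u by rewrite mulmxKV.
  exists (y 0 0), (y 0 1), (y 0 2%:R).
  have -> : t u = - y 0 3%:R.
    rewrite /t /y /invmx uNu mulNr mxE mulr_suml; congr (- _).
    by apply: eq_bigr => j _; rewrite !mxE; ring.
  by rewrite {1}xE mul_rows4 scaleNr addrK.
have curveE s : J s -> derive1 (fun r => ruled_map g r (t r)) s =
    derive1 x s + (t s *: derive1 e s + derive1 t s *: e s).
  move=> Js; have Is := JI s Js.
  have d1 := is_derive_derive1 (Ck_diff (Cx 1%N) Is).
  have d2 := is_derive_scale_row (Ck_diff (Ct 1%N) Js) (Ck_diff (Ce 1%N) Is).
  by have [_ H] := is_deriveD d1 d2; rewrite derive1E [LHS]H.
exists J, id, t; split.
- split.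
  + exact: oJ.
  + move=> a b Ja Jb z /andP[az zb]; move: Ja Jb.
    rewrite /J /ball /= !sub0r !normrN !ltr_norml.
    by move=> /andP[? ?] /andP[? ?]; apply/andP; split; lra.
  + apply/smooth_curveP => // k; apply: (@Ck_linear _ _ _ k J idfun).
    by move=> z; exact: cvg_id.
  + exact/smooth_curveP.
  + move=> s Js; split; first exact: JI.
    rewrite curveE //; apply/eqP => cE.
    (* A vanishing velocity x' + t e' + t' e would be a linear relation between the rows of [N s]
       with these coefficients, the first of which is 1. *)
    pose v : 'rV[R]_4 := \row_(i < 4) [:: 1; derive1 t s; t s; 0]`_i.
    have vN : v *m N s = 0.
      rewrite mul_rows4 !mxE /= scale1r scale0r addr0 -cE -!addrA.
      by congr (_ + _); rewrite addrC.
    have : v = 0 by rewrite -[v](mulmxK (JN s Js)) vN mul0mx.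
    by move/rowP => /(_ 0); rewrite !mxE /= => /eqP; rewrite oner_eq0.
- move=> s Js; have [y0 [y1 [y2 yE]]] := oscE s Js.
  exact: (real_inflection_criterion oI (JI s Js) (JN s Js) yE).
- split; first by exists 0; split=> //; exact: ballxx.
  move=> s Js s0; rewrite /id in s0; rewrite -s0 /id curveE //.
  have Is := JI s Js.
  have -> : tangent_plane g s (t s) =
      col_mx (derive1 x s + t s *: derive1 e s) (e s).
    congr col_mx.
      exact: derive1DZ (Ck_diff (Cx 1%N) Is) (Ck_diff (Ce 1%N) Is).
    have did : differentiable (id : R -> R) (t s) by exact/derivable1_diffP.
    have dcst : differentiable (cst (e s)) (t s) by exact: differentiable_cst.
    have [_ H] := is_deriveD (is_derive_cst (x s) (t s) 1)
      (is_derive_scale_row did dcst).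
    rewrite derive1E [LHS]H.
    by rewrite derive1_cst derive1_id scaler0 !add0r scale1r.
  (* The velocity differs from F_u by t' e, a vector of the ruling, so each of the two spans the
     same plane together with e. *)
  rewrite addrA; apply/eqmxP; apply: eqmx_trans (addsmxE _ _).
  apply/eqmxP; rewrite !addsmx_sub !addsmxSr !andbT; apply/andP; split.
    by rewrite addmx_sub ?addsmxSl // scalemx_sub // addsmxSr.
  rewrite -[X in (X <= _)%MS](addrK (derive1 t s *: e s)) -scaleNr.
  by rewrite addmx_sub ?addsmxSl // scalemx_sub // addsmxSr.
Unshelve. all: by end_near.
Qed.
End inflection_curve.

(** * A smooth bump function *)

Section flat.
Context (R : realType).
Implicit Types (x : R) (n : nat).

(* The factors x^-n make the family stable under differentiation. *)
Definition flat n x : R := if 0 < x then x^-1 ^+ n * expR (- x^-1) else 0.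

Lemma flat_le0 n x : x <= 0 -> flat n x = 0.
Proof. by rewrite /flat ltNge => ->. Qed.

Lemma flatE n x : 0 < x -> flat n x = x^-1 ^+ n * expR (- x^-1).
Proof. by rewrite /flat => ->. Qed.

(** With y = 1/x, the exponential series gives exp y >= y^(n+2) / (n+2)!. A bound quadratic in x is
    what makes the derivative at 0 exist and vanish. *)
Lemma flat_le n x : `|flat n x| <= n.+2`!%:R * `|x| ^+ 2.
Proof.
rewrite /flat; case: ifPn => [x0|_]; last first.
  by rewrite normr0 mulr_ge0 // exprn_ge0.
have f0 : 0 < (n.+2`!%:R : R) by rewrite ltr0n fact_gt0.
have ix0 : 0 < x^-1 by rewrite invr_gt0.
rewrite (gtr0_norm x0) gtr0_norm; last by rewrite mulr_gt0 ?exprn_gt0 ?expR_gt0.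
rewrite expRN ler_pdivrMr ?expR_gt0 //.
have := expR_ge1Dxn n.+1 (ltW ix0).
rewrite -(ler_pM2l (mulr_gt0 f0 (exprn_gt0 2 x0))); apply: le_trans.
rewrite mulrDr mulr1 -[leLHS]add0r lerD //.
  by rewrite mulr_ge0 ?ltW ?exprn_gt0.
rewrite -[n.+2]/(2 + n)%N exprD exprVn le_eqVlt; apply/orP; left; apply/eqP.
field; rewrite (gt_eqF f0) expf_neq0 (gt_eqF x0) //.
Qed.

Lemma is_derive_flat n x :
  is_derive x 1 (flat n) (flat n.+2 x - n%:R * flat n.+1 x).
Proof.
have [x0|x0|->] := ltgtP x 0.
- rewrite !flat_le0 ?ltW // mulr0 subr0.
  have E : \forall y \near x, cst 0 y = flat n y.
    by apply: filterS (lt_nbhsl x0) => y y0; rewrite flat_le0 // ltW.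
  exact: near_eq_is_derive E (is_derive_cst _ _ _).
- rewrite !flatE //.
  have E : \forall y \near x, y^-1 ^+ n * expR (- y^-1) = flat n y.
    by apply: filterS (lt_nbhsr x0) => y y0; rewrite flatE.
  apply: near_eq_is_derive E _.
  have xN0 : id x != 0 by rewrite gt_eqF.
  have dV : is_derive x 1 (fun y => y^-1) (- x^-1 ^+ 2).
    have dI := @derivableV _ _ (id : R -> R) x 1 xN0 (@derivable_id _ _ x 1).
    have DI := @deriveV _ _ (id : R -> R) x 1 xN0 (@derivable_id _ _ x 1).
    apply: DeriveDef; first exact: dI.
    by rewrite [LHS]DI derive_id exprVn [LHS]mulr1.
  have dN : is_derive x 1 (fun y => - y^-1) (- - x^-1 ^+ 2) := is_deriveN dV.
  have -> : (fun y : R => y^-1 ^+ n * expR (- y^-1)) =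
      (fun y : R => y^-1) ^+ n * (expR \o (fun y : R => - y^-1)).
    by rewrite exprfctE.
  have H := is_deriveM (is_deriveX n dV)
    (is_derive1_comp (g := fun y => - y^-1) (is_derive_expR (- x^-1)) dN).
  apply: (is_derive_eq H).
  rewrite /GRing.scale /= exprfctE.
  (* The derivative of an n-th power involves the predecessor of n, so n = 0 is treated apart. *)
  case: n {H} => [|n].
    by rewrite !mul0r mulr0 addr0 !subr0 expr0 mul1r opprK mulrC.
  rewrite -[n.+1.-1]/n -[n.+3]/(2 + n.+1)%N !exprS; ring.
- rewrite !(flat_le0 _ (lexx 0)) mulr0 subr0.
  have [||d D] := @linear_approx_diff _ _ _ (flat n) (\0 : {linear R -> R}) 0.
  + by move=> z; exact: cvg_cst.
  + move=> eps eps0.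
    have f0 : 0 < (n.+2`!%:R : R) by rewrite ltr0n fact_gt0.
    near=> h.
    rewrite addr0 (flat_le0 _ (lexx 0)) !subr0 (le_trans (flat_le _ _)) //.
    rewrite expr2 mulrA.
    apply: ler_wpM2r => //; rewrite -ler_pdivlMl //.
    by near: h; apply: (@nbhs0_le R R^o); rewrite mulr_gt0 // invr_gt0.
  by apply: DeriveDef; [exact: diff_derivable|rewrite deriveE // D].
Unshelve. all: by end_near.
Qed.

Lemma Ck_flat k n (A : set R) : open A -> Ck k A (flat n).
Proof.
move=> oA; elim: k n => [//|k IH] n; split=> [p _|v].
  by apply/derivable1_diffP; have [] := is_derive_flat n p.
have H : Ck k A (fun p => v *: (flat n.+2 p - n%:R *: flat n.+1 p)).
  by apply: CkZ => //; apply: CkB => //; exact: CkZ.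
apply: Ck_eq H => // p _; have [df D] := is_derive_flat n p.
rewrite deriveE; last exact/derivable1_diffP.
by rewrite deriv1E // derive1E D.
Qed.

Lemma flat_gt0 n x : 0 < x -> 0 < flat n x.
Proof.
by move=> x0; rewrite flatE // mulr_gt0 ?expR_gt0 // exprn_gt0 // invr_gt0.
Qed.

End flat.

Lemma derive1_idM (R : realType) (h : R -> R) (u : R) : differentiable h u ->
  derive1 (fun s => s * h s) u = h u + u * derive1 h u.
Proof.
move=> /is_derive_derive1 dh; have [_ H] := is_deriveM (is_derive_id u 1) dh.
by rewrite derive1E [LHS]H addrC /GRing.scale /= mulr1.
Qed.

(** Take phi(u) = u^2 psi(u), where psi(u) is [flat 0 (r + u) * flat 0 (r - u)], which vanishes for
    |u| >= r and is positive at 0. Written as u (u psi), it yields phi''(0) = 2 psi(0) by two uses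
    of the product rule. *)
Lemma smooth_bump (R : realType) (r : R) : 0 < r -> exists phi : R -> R,
  [/\ forall k (A : set R), open A -> Ck k A phi,
      forall u, r <= `|u| -> phi u = 0,
      phi 0 = 0, derive1 phi 0 = 0 & derive1 (derive1 phi) 0 != 0].
Proof.
move=> r0; pose psi u : R := flat 0 (r + u) * flat 0 (r - u).
have Cid k (A : set R) : Ck k A (id : R -> R).
  by apply: (@Ck_linear _ _ _ k A idfun) => z; exact: cvg_id.
have Cpsi k (A : set R) : open A -> Ck k A psi.
  move=> oA; have oT := @openT R.
  have C1 : Ck k A (fun u => r + u) by apply: CkD => //; exact: Ck_cst.
  have C2 : Ck k A (fun u => r - u) by apply: CkB => //; exact: Ck_cst.
  by apply: CkM => //; [exact: Ck_comp oA _ (Ck_flat k 0 oT) C1|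
    exact: Ck_comp oA _ (Ck_flat k 0 oT) C2].
pose h u := u * psi u.
have Ch k (A : set R) : open A -> Ck k A h.
  by move=> oA; apply: CkM => //; exact: Cpsi.
have dif (f : R -> R) (u : R) : (forall k (A : set R), open A -> Ck k A f) ->
    differentiable f u.
  by move=> Cf; exact: Ck_diff (Cf 1%N setT openT) I.
have Cdh k : Ck k setT (derive1 h).
  exact: Ck_derive1 openT (fun j => Ch j setT openT) k.
have dphi u : derive1 (fun s => s * h s) u = h u + u * derive1 h u.
  by apply: derive1_idM; exact: dif.
exists (fun u => u * h u); split.
- by move=> k A oA; apply: CkM => //; exact: Ch.
- move=> u; rewrite ler_normr /h /psi => /orP[ur|ur].
    by rewrite [flat 0 (r - u)]flat_le0 ?subr_le0 // !mulr0.
  rewrite [flat 0 (r + u)]flat_le0 ?mul0r ?mulr0 //.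
  by rewrite -[u]opprK subr_le0.
- by rewrite mul0r.
- by rewrite dphi /h !mul0r addr0.
- have -> : derive1 (fun s => s * h s) = (fun u => h u + u * derive1 h u).
    exact/funext.
  have d1 := is_derive_derive1 (dif h 0 Ch).
  have d2 : is_derive (0 : R) 1 (fun u => u * derive1 h u)
      (derive1 (fun u => u * derive1 h u) 0).
    apply: is_derive_derive1; apply: (Ck_diff (n := 0) (A := setT)) => //.
    exact: CkM openT (Cid _ _) (Cdh _).
  have [_ H] := is_deriveD d1 d2; rewrite derive1E [X in X != 0]H.
  rewrite derive1_idM; last exact: Ck_diff (Cdh 1%N) I.
  rewrite mul0r addr0 (derive1_idM (dif psi 0 Cpsi)) mul0r addr0.
  rewrite /psi addr0 subr0 -mulr2n mulrn_eq0 /= mulf_neq0 //.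
    by rewrite gt_eqF // flat_gt0.
  by rewrite gt_eqF // flat_gt0.
Qed.

(** * Invertibility of matrices given by four rows *)

Section rows4_unit.
Context (R : fieldType).
Implicit Types a b c d v : 'rV[R]_4.

Lemma rows4_unit_sub a b c d (N : 'M[R]_4) : rows4 a b c d \in unitmx ->
  (a <= N)%MS -> (b <= N)%MS -> (c <= N)%MS -> (d <= N)%MS -> N \in unitmx.
Proof.
rewrite -!row_full_unit -!sub1mx => /submx_trans uN aN bN cN dN; apply: uN.
by apply/row_subP; apply: ord4_ind; rewrite rowK.
Qed.

Lemma rows4_sub a b c d : [/\ (a <= rows4 a b c d)%MS, (b <= rows4 a b c d)%MS,
  (c <= rows4 a b c d)%MS & (d <= rows4 a b c d)%MS].
Proof.
have H i (x : 'rV[R]_4) : row i (rows4 a b c d) = x -> (x <= rows4 a b c d)%MS.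
  by move=> <-; exact: row_sub.
split; [apply: (H 0)|apply: (H 1)|apply: (H 2%:R)|apply: (H 3%:R)];
  by rewrite rowK.
Qed.

Lemma rows4_unit_shift a b c v (beta gamma : R) : rows4 a b c v \in unitmx ->
  rows4 a (b + beta *: v) (c + gamma *: v) v \in unitmx.
Proof.
move=> uN; have [sa sb sc sv] := rows4_sub a (b + beta *: v) (c + gamma *: v) v.
apply: (rows4_unit_sub uN) => //.
  rewrite -[X in (X <= _)%MS](addrK (beta *: v)) -scaleNr.
  by rewrite addmx_sub ?scalemx_sub.
rewrite -[X in (X <= _)%MS](addrK (gamma *: v)) -scaleNr.
  by rewrite addmx_sub ?scalemx_sub.
Qed.

(** An exchange argument: as y3 is nonzero, v can be recovered from a, b, c and d. *)
Lemma rows4_unit_last a b c d v (y0 y1 y2 y3 : R) : rows4 a b c v \in unitmx ->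
  d = y0 *: a + y1 *: b + y2 *: c + y3 *: v -> y3 != 0 ->
  rows4 a b c d \in unitmx.
Proof.
move=> uN dE y30; have [sa sb sc sd] := rows4_sub a b c d.
apply: (rows4_unit_sub uN) => //.
have -> : v = y3^-1 *: (d - (y0 *: a + y1 *: b + y2 *: c)).
  by rewrite dE addrAC subrr add0r scalerA mulVf // scale1r.
rewrite scalemx_sub // addmx_sub // -scaleN1r scalemx_sub //.
by rewrite !addmx_sub // scalemx_sub.
Qed.

Lemma rows4_unit_neq0 a b c d : rows4 a b c d \in unitmx -> b != 0.
Proof.
move=> uN; apply/eqP => b0.
have := row_mul_invmx 1 uN; rewrite rowK /= b0 mul0mx => /rowP /(_ 1).
by rewrite !mxE eqxx => /eqP; rewrite eq_sym oner_eq0.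
Qed.

(** Adding the single vector d raises the rank of the other three by at most one, and the total is
    4. *)
Lemma rows4_unit_row_free a b c d : rows4 a b c d \in unitmx ->
  row_free (col_mx a (col_mx b c)).
Proof.
set X := col_mx _ _ => uN.
have aX : (a <= X)%MS by rewrite /X -(addsmxE a) addsmxSl.
have bcX : (col_mx b c <= X)%MS by rewrite /X -(addsmxE a) addsmxSr.
have bX : (b <= X)%MS by apply: submx_trans bcX; rewrite -addsmxE addsmxSl.
have cX : (c <= X)%MS by apply: submx_trans bcX; rewrite -addsmxE addsmxSr.
have uXd : (X + d)%MS \in unitmx.
  apply: (rows4_unit_sub uN); last exact: addsmxSr.
  - exact: submx_trans aX (addsmxSl _ _).
  - exact: submx_trans bX (addsmxSl _ _).
  - exact: submx_trans cX (addsmxSl _ _).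
rewrite -row_leq_rank -(leq_add2r 1).
have := mxrank_adds_leqif X d; rewrite mxrank_unit // => -[+ _].
move=> /leq_trans; apply; rewrite leq_add2l; exact: rank_leq_row.
Qed.

(** Some standard basis vector lies outside the three-dimensional row space; it completes the
    frame. *)
Lemma row_free_rows4_unit a b c : row_free (col_mx a (col_mx b c)) ->
  exists d, rows4 a b c d \in unitmx.
Proof.
set X := col_mx _ _ => fX.
have [i dX] : exists i, ~~ ((delta_mx 0 i : 'rV[R]_4) <= X)%MS.
  apply/existsP; rewrite -negb_forall; apply/negP => /forallP H.
  have : (1%:M <= X)%MS by apply/row_subP => i; rewrite row1 H.
  move=> /mxrankS; rewrite mxrank1 => /leq_trans /(_ (rank_leq_row _)).
  by [].
exists (delta_mx 0 i); set N := rows4 _ _ _ _.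
have [sa sb sc sd] := rows4_sub a b c (delta_mx 0 i).
rewrite -row_free_unit -row_leq_rank.
have lt : (X < X + (delta_mx 0 i : 'rV[R]_4))%MS.
  by rewrite /ltmx addsmxSl addsmx_sub submx_refl.
have := rank_ltmx lt; rewrite (eqP (fX : \rank X == 3)%N) => /leq_trans; apply.
apply: mxrankS; rewrite addsmx_sub sd andbT.
by rewrite /X -addsmxE addsmx_sub sa -addsmxE addsmx_sub sb.
Qed.

End rows4_unit.

(** * Genericity *)

Lemma Ck_mx_coord (R : realType) (m n k : nat) (A : set 'M[R]_(m, n)) i j :
  Ck k A (fun M => M i j).
Proof.
have lin : linear (fun M : 'M[R]_(m, n) => M i j) by move=> c u v; rewrite !mxE.
pose F := GRing.isLinear.Build R 'M[R]_(m, n) R *:%R (fun M => M i j) lin.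
pose f : {linear 'M[R]_(m, n) -> R} :=
  HB.pack (fun M : 'M[R]_(m, n) => M i j) F.
exact: (@Ck_linear _ _ _ k A f (@coord_continuous _ _ _ i j)).
Qed.

Lemma det_continuous (R : realType) (n : nat) :
  continuous (fun M : 'M[R]_n => \det M).
Proof.
move=> M; apply: differentiable_continuous.
have C : Ck 1%N setT (fun M : 'M[R]_n => \det M).
  by apply: (Ck_det (N := id) openT) => i j; exact: Ck_mx_coord.
exact: Ck_diff C (I : setT M).
Qed.

Lemma ball_rows4 (R : realType) (a b c d a' b' c' d' : 'rV[R]_4) (eps : R) :
  0 < eps -> `|a' - a| < eps -> `|b' - b| < eps -> `|c' - c| < eps ->
  `|d' - d| < eps -> ball (rows4 a b c d) eps (rows4 a' b' c' d').
Proof.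
move=> eps0 ha hb hc hd; split; first exact: eps0.
have H (x y : 'rV[R]_4) j : `|y - x| < eps -> ball (x 0 j) eps (y 0 j).
  by move=> xy; have [_] : ball x eps y by rewrite -ball_normE /= distrC.
by apply: ord4_ind => j; rewrite !mxE; exact: H.
Qed.

(** The condition is imposed at u = 0 alone, as the inflection curve is only sought near the ruling
    over 0. *)
Definition nondegenerate (R : realType) (I : set R) : set (ruled_data I) :=
  [set g | rows4 (derive1 (rd_x g) 0) (rd_e g 0) (derive1 (rd_e g) 0)
    (derive1 (derive1 (rd_e g)) 0) \in unitmx].

(** The determinant is a continuous function of derivatives of order at most 2 at one point, so a
    Whitney ball of order 2 with constant radius suffices. *)
Lemma open_nondegenerate (R : realType) (I : set R) : I 0 ->
  open (@nondegenerate R I).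
Proof.
move=> I0; change (whitney_open (@nondegenerate R I)) => g.
rewrite {1}/nondegenerate /=; set N := rows4 _ _ _ _ => uN.
have dN : \det N != 0 by rewrite -unitfE -unitmxE.
have : \forall M \near N, \det M != 0.
  exact: (cvgr_neq0 _ (det_continuous (x := N)) dN).
move=> /nbhs_ballP[eps eps0 H].
exists 2%N, (cst eps); split.
  by move=> u _; split; [exact: eps0|exact: cst_continuous].
move=> h hh; rewrite /nondegenerate /=; set Nh := rows4 _ _ _ _.
rewrite unitmxE unitfE; apply: H.
exact: (ball_rows4 eps0 (hh 1%N 0 isT I0).1 (hh 0%N 0 isT I0).2
  (hh 1%N 0 isT I0).2 (hh 2%N 0 isT I0).2).
Qed.

Section row_multiples.
Context (R : realType) (E V : normedModType R).
Implicit Types (k : E -> R) (v : V).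

Lemma CkZl n (A : set E) k v : open A -> Ck n A k -> Ck n A (fun p => k p *: v).
Proof.
move=> oA; elim: n k => [//|n IH] k Ckk; split=> [p Ap|w].
  by apply: differentiableZl; exact: Ck_diff Ckk Ap.
apply: Ck_eq (IH _ (Ckk.2 w)) => // p Ap.
have dk := Ck_diff Ckk Ap.
by rewrite !deriveE ?diffZl //; exact: differentiableZl.
Qed.

End row_multiples.

Lemma Ck_derive1n (R : realType) (V : normedModType R) (A : set R) (f : R -> V)
    j : open A -> (forall k, Ck k A f) -> forall k, Ck k A (derive1n j f).
Proof. by move=> oA Cf; elim: j => [//|j IH]; exact: Ck_derive1. Qed.

Lemma derive1nDZl (R : realType) (V : normedModType R) (A : set R) (f : R -> V)
    (phi : R -> R) (c : R) (v : V) j : open A ->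
  (forall k, Ck k A f) -> (forall k, Ck k A phi) -> forall u, A u ->
  derive1n j (fun s => f s + c *: (phi s *: v)) u =
    derive1n j f u + c *: (derive1n j phi u *: v).
Proof.
move=> oA Cf Cphi; elim: j => [//|j IH] u Au.
rewrite !derive1nS (eq_derive1 oA Au IH).
have df := Ck_diff (Ck_derive1n j oA Cf 1%N) Au.
have dphi := Ck_diff (Ck_derive1n j oA Cphi 1%N) Au.
have dphiv : differentiable (fun s => derive1n j phi s *: v) u.
  exact: differentiableZl.
rewrite (derive1DZ c df dphiv); congr (_ + c *: _).
by rewrite !derive1E !deriveE // diffZl.
Qed.

Lemma normrZ2 (R : realType) (V : normedModType R) (a b : R) (v : V) : 0 < a ->
  `|a *: (b *: v)| = a * (`|b| * `|v|).
Proof. by move=> a0; rewrite !normrZ gtr0_norm. Qed.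

Section perturbation.
Context (R : realType) (I : set R).
Hypothesis oI : open I.
Hypothesis I0 : I 0.

Lemma dense_nondegenerate : dense (@nondegenerate R I).
Proof.
move=> O [g Og] oO; have [k [d [dr dO]]] := (oO : whitney_open O) g Og.
have [uN|nuN] := boolP (rows4 (derive1 (rd_x g) 0) (rd_e g 0)
  (derive1 (rd_e g) 0) (derive1 (derive1 (rd_e g)) 0) \in unitmx).
  by exists g.
have [v uv] := row_free_rows4_unit (rd_indep g I0).
pose x := rd_x g; pose e := rd_e g.
have Cx j : Ck j I x by exact: (smooth_curveP x oI).1 (@rd_x_smooth _ _ g) j.
have Ce j : Ck j I e by exact: (smooth_curveP e oI).1 (@rd_e_smooth _ _ g) j.
pose Nv u := rows4 (derive1 x u) (e u) (derive1 e u) v.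
have [r1 r10 Hr1] : exists2 r1, 0 < r1 &
    forall u : R, ball 0 r1 u -> I u /\ Nv u \in unitmx.
  have : \forall u \near (0 : R), I u /\ \det (Nv u) != 0.
    near=> u; split; near: u; first exact: open_nbhs_nbhs.
    have CN j i i' : Ck j I (fun u => Nv u i i').
      exact: (Ck_rows4 oI i i' (Ck_derive1 oI Cx j) (Ce j) (Ck_derive1 oI Ce j)
        (Ck_cst j I v)).
    have c0 : continuous_at 0 (fun u => \det (Nv u)).
      apply/differentiable_continuous/(Ck_diff _ I0).
      exact: (Ck_det (N := Nv) oI (CN 1%N)).
    by apply: (cvgr_neq0 _ c0); rewrite -unitfE -unitmxE.
  move=> /nbhs_ballP[r1 r10 H]; exists r1; first exact: r10.
  move=> u /H[Iu dN]; split; first exact: Iu.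
  rewrite unitmxE unitfE; exact: dN.
(* With the smaller radius the closed interval [-r, r], which contains the support of the bump, lies
   where v is independent of x', e and e'. *)
pose r := r1 / 2.
have r0 : 0 < r by rewrite divr_gt0.
have rr1 : r < r1 by rewrite /r; lra.
have [phi [Cphi phir phi0 dphi0 ddphi0]] := smooth_bump r0.
have Cphi' j : Ck j I phi by exact: Cphi.
(* The bump vanishes on this open set, hence so do all its derivatives there. *)
have oOut : open [set u : R | r < `|u|].
  apply: (@open_comp _ _ (fun u : R => `|u|) [set y | r < y]).
    by move=> u _; exact: norm_continuous.
  exact: open_gt.
have phiout j u : r < `|u| -> derive1n j phi u = 0.
  elim: j u => [|j IH] u ru; first exact/phir/ltW.
  by rewrite derive1nS (eq_derive1 (h := cst 0) oOut ru IH) derive1_cst.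
have rI u : `|u| <= r -> I u.
  move=> ur; apply: (Hr1 u _).1.
  by rewrite /ball /= sub0r normrN (le_lt_trans ur).
have rr : - r <= r by lra.
have inr (u : R) : (u \in `[- r, r]%R) = (`|u| <= r).
  by rewrite in_itv /= ler_norml.
(* The Whitney radius may tend to 0 at the ends of I, but on the compact interval [-r, r] it attains
   a positive minimum. Outside, the perturbation is zero and any positive radius will do. *)
have [c c0 cd] : exists2 c, 0 < c & forall u, `|u| <= r -> c <= d u.
  have [|u0 u0r Hu] := @EVT_min _ d (- r) r rr.
    apply: continuous_in_subspaceT => u; rewrite inE /= inr => ur.
    exact: (dr u (rI u ur)).2.
  rewrite inr in u0r; exists (d u0); first exact: (dr u0 (rI _ u0r)).1.
  by move=> u ur; apply: Hu; rewrite inr.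
have bnd j : exists2 C, 0 < C & forall u, `|u| <= r ->
    `|derive1n j phi u| <= C.
  have [|u0 u0r Hu] := @EVT_max _ (fun u => `|derive1n j phi u|) (- r) r rr.
    apply: continuous_subspaceT => u.
    apply: (@continuous_comp _ _ _ (derive1n j phi) (fun y : R => `|y|)).
      apply/differentiable_continuous.
      have CT l : Ck l setT phi by exact: Cphi openT.
      exact: Ck_diff (Ck_derive1n j openT CT 1%N) Logic.I.
    exact: norm_continuous.
  exists (`|derive1n j phi u0| + 1); first by rewrite ltr_wpDl.
  by move=> u ur; rewrite (le_trans (Hu u _)) ?inr // lerDl.
have [C C0 Cphid] : exists2 C, 0 < C & forall j u, (j <= k)%N -> `|u| <= r ->
    `|derive1n j phi u| <= C.
  elim: {dO} k => [|k [C C0 HC]].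
    have [C C0 HC] := bnd 0%N; exists C => // j u.
    by rewrite leqn0 => /eqP ->; exact: HC.
  have [C' C'0 HC'] := bnd k.+1; exists (Num.max C C').
    by rewrite lt_max C0.
  move=> j u; rewrite leq_eqVlt ltnS le_max => /predU1P[->|jk] ur.
    by rewrite HC' // orbT.
  by rewrite HC.
(* Chosen so that every derivative of the perturbation up to order k is at most eps C (|v| + 1) =
   c/2 on [-r, r], which is below the Whitney radius. *)
pose eps := c / (2 * C * (`|v| + 1)).
have eps0 : 0 < eps by rewrite divr_gt0 // !mulr_gt0 // ltr_wpDl.
pose e1 u := e u + eps *: (phi u *: v).
have Ce1 j : Ck j I e1.
  by apply: CkD => //; apply: CkZ => //; exact: CkZl.
have e1E j u : I u ->
    derive1n j e1 u = derive1n j e u + eps *: (derive1n j phi u *: v).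
  by move=> Iu; apply: (derive1nDZl _ _ _ oI).
have se1 : smooth_curve I e1 by exact/smooth_curveP.
have sx : smooth_curve I x by exact: rd_x_smooth.
have e1out u : I u -> r < `|u| -> e1 u = e u /\ derive1 e1 u = derive1 e u.
  move=> Iu ru; have := e1E 0%N u Iu; have := e1E 1%N u Iu.
  by rewrite !phiout // scale0r scaler0 !addr0.
have e1in u : I u -> `|u| <= r ->
    rows4 (derive1 x u) (e1 u) (derive1 e1 u) v \in unitmx.
  move=> Iu ur; have := e1E 1%N u Iu => /= e1'.
  rewrite [derive1 e1 u]e1' /e1 !scalerA; apply: rows4_unit_shift.
  by apply: (Hr1 u _).2; rewrite /ball /= sub0r normrN (le_lt_trans ur).
have e10 u : I u -> e1 u != 0.
  move=> Iu; have [ur|ru] := leP `|u| r.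
    exact: rows4_unit_neq0 (e1in u Iu ur).
  by rewrite (e1out u Iu ru).1 rd_e_neq0.
have e1indep u : I u ->
    row_free (col_mx (derive1 x u) (col_mx (e1 u) (derive1 e1 u))).
  move=> Iu; have [ur|ru] := leP `|u| r.
    exact: rows4_unit_row_free (e1in u Iu ur).
  by rewrite (e1out u Iu ru).1 (e1out u Iu ru).2 rd_indep.
pose h := RuledData sx se1 e10 e1indep.
exists h; split.
  apply: dO => j u jk Iu; split.
    by rewrite subrr normr0; exact: (dr u Iu).1.
  rewrite [derive1n j (rd_e h) u](e1E j u Iu) addrAC subrr add0r.
  have [ur|ru] := leP `|u| r; last first.
    by rewrite phiout // scale0r scaler0 normr0; exact: (dr u Iu).1.
  apply: lt_le_trans (cd u ur).
  rewrite (normrZ2 _ _ eps0).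
  apply: (@le_lt_trans _ _ (eps * (C * (`|v| + 1)))).
    apply: ler_wpM2l; first exact: ltW.
    by apply: ler_pM => //; [exact: Cphid|rewrite lerDl].
  have -> : eps * (C * (`|v| + 1)) = c / 2.
    rewrite /eps; field; rewrite (gt_eqF C0) /= gt_eqF // ltr_wpDl //.
  by rewrite ltr_pdivrMr //; lra.
rewrite /nondegenerate /=.
have -> : derive1 e1 0 = derive1 e 0.
  by rewrite [LHS](e1E 1%N 0 I0) [derive1n 1 phi 0]dphi0 scale0r scaler0 addr0.
have -> : e1 0 = e 0 by rewrite /e1 phi0 scale0r scaler0 addr0.
have -> : derive1 (derive1 e1) 0 = derive1 (derive1 e) 0 +
    (eps * derive1 (derive1 phi) 0) *: v.
  by rewrite [LHS](e1E 2%N 0 I0) scalerA.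
pose y := derive1 (derive1 e) 0 *m invmx (Nv 0).
have eE : derive1 (derive1 e) 0 = y 0 0 *: derive1 x 0 + y 0 1 *: e 0 +
    y 0 2%:R *: derive1 e 0 + y 0 3%:R *: v by rewrite -mul_rows4 mulmxKV.
(* g being degenerate, e''(0) has no component along v. *)
have y30 : y 0 3%:R = 0.
  apply/eqP; apply: contraNT nuN => y3; exact: rows4_unit_last uv eE y3.
(* The component of the new second derivative along v is now exactly eps phi''(0), which is
   nonzero. *)
apply: (rows4_unit_last (y0 := y 0 0) (y1 := y 0 1) (y2 := y 0 2%:R) uv).
  by rewrite [in LHS]eE y30 scale0r addr0.
by rewrite mulf_neq0 // gt_eqF.
Unshelve. all: by end_near.
Qed.

End perturbation.

Theorem corollary2p3 (R : realType) (I : set R)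
    (I_open : open I) (I_itv : is_interval I) (I_0 : I 0) :
  residual [set g : ruled_data I |
    exists (J : set R) (u t : R -> R),
      [/\ regular_curve_on g J u t,
          forall s, J s -> real_inflection g (u s) (t s)
        & transverse_to_ruling g J u t 0]].
Proof.
(* A single open dense set is enough; the sequence repeats it. *)
exists (fun=> @nondegenerate R I); split.
  by move=> _; split; [exact: open_nondegenerate|exact: dense_nondegenerate].
move=> g /(_ 0%N Logic.I) uN; exact: inflection_curve I_open I_0 uN.
Qed.
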